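(* Let $k$ be a field and let $A=kQ/I$ be a finite-dimensional $k$-algebra. If $A$ is both special multiserial and special quasi-biserial, then $A$ is special biserial.
   Context: Quivers are finite; paths are written from right to left; $s(\alpha),t(\alpha)$ denote source and target. In $A=kQ/I$ the ideal $I$ of $kQ$ is admissible, i.e. $\langle Q_1\rangle^m\subseteq I\subseteq\langle Q_1\rangle^2$ for some $m\ge2$, where $Q_1$ is the set of arrows. Special biserial: Morita equivalent to some $kQ/I$, $I$ admissible, such that (1) at every vertex of $Q$ at most two arrows start and at most two arrows end; (2) for every arrow $\alpha$ there is at most one arrow $\beta$ with $\beta\alpha\notin I$ and at most one arrow $\gamma$ with $\alpha\gamma\notin I$. Special multiserial: Morita equivalent to some $kQ/I$, $I$ admissible, such that for every arrow $\alpha$ there is at most one arrow $\beta$ with $\alpha\beta\notin I$ and at most one arrow $\gamma$ with $\gamma\alpha\notin I$. Single arrows: in a quiver with at most two arrows starting and at most two arrows ending at each vertex, an arrow $\alpha$ is non-single if there is another arrow $\beta\ne\alpha$ with $s(\beta)=s(\alpha)$ or $t(\beta)=t(\alpha)$; otherwise it is single. Special quasi-biserial: Morita equivalent to some $kQ/I$, $I$ admissible, such that (1) at every vertex of $Q$ at most two arrows start and at most two arrows end; (2) for each path $p$ containing at least one non-single arrow there is at most one arrow $\beta$ with $\beta p\notin I$ and at most one arrow $\gamma$ with $p\gamma\notin I$. *)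

(* Defs.v *)
From HB Require Import structures.
From mathcomp Require Import all_boot all_order all_algebra.
From mathcomp Require Import finmap.
From mathcomp Require Import boolp classical_sets.
From mathcomp Require Import monalg.

Set Implicit Arguments.
Unset Strict Implicit.
Unset Printing Implicit Defensive.

Import GRing.Theory.

Local Open Scope classical_set_scope.
Local Open Scope ring_scope.

(* A k-algebra is a ring with a morphism from k to its centre. MathComp's algType
   only covers nonzero rings, whereas the path algebra of the empty quiver and
   the quotient by the unit ideal are zero. *)
HB.mixin Record PzRing_isAlgebraOver (k : comPzRingType) A of GRing.PzRing A := {
  kmap : {rmorphism k -> A};
  kmap_central : forall (c : k) (x : A), kmap c * x = x * kmap c
}.

#[short(type="kalgType")]
HB.structure Definition AlgebraOver (k : comPzRingType) :=
  {A of GRing.PzRing A & PzRing_isAlgebraOver k A}.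

Definition finite_dimensional (k : comPzRingType) (A : kalgType k) : Prop :=
  exists (n : nat) (v : 'I_n -> A),
    forall x : A, exists c : 'I_n -> k, x = \sum_(i < n) kmap (c i) * v i.

Definition is_ideal (R : pzRingType) (I : set R) : Prop :=
  [/\ I 0,
      forall x y, I x -> I y -> I (x - y),
      forall a x, I x -> I (a * x)
    & forall a x, I x -> I (x * a)].

Record ideal (R : pzRingType) := Ideal {
  ideal_set :> set R;
  idealP : is_ideal ideal_set
}.

Definition ideal_gen (R : pzRingType) (S : set R) : set R :=
  smallest (@is_ideal R) S.

Definition ideal_mul (R : pzRingType) (I J : set R) : set R :=
  ideal_gen [set z | exists x y, [/\ I x, J y & z = x * y]].

Definition ideal_exp (R : pzRingType) (I : set R) (n : nat) : set R :=
  iter n (ideal_mul I) setT.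

Section QuotientAlgebra.
Variables (k : comPzRingType) (A : kalgType k) (I : ideal A).

Definition ideal_pred : {pred A} := fun x => `[< ideal_set I x >].

Lemma ideal_predP x : reflect (ideal_set I x) (x \in ideal_pred).
Proof. exact: asboolP. Qed.

Fact ideal_pred_zmod_closed : zmod_closed ideal_pred.
Proof.
have [I0 IB _ _] := idealP I; split; first exact/ideal_predP.
by move=> x y /ideal_predP Ix /ideal_predP Iy; apply/ideal_predP/IB.
Qed.

HB.instance Definition _ :=
  GRing.isZmodClosed.Build A ideal_pred ideal_pred_zmod_closed.

Definition quot_alg : Type := Quotient.quot ideal_pred.

HB.instance Definition _ := GRing.Zmodule.on quot_alg.

Definition quot_pi (x : A) : quot_alg := \pi_(Quotient.quot ideal_pred)%qT x.
Definition quot_repr (x : quot_alg) : A :=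
  (repr (x : Quotient.quot ideal_pred))%qT.

Lemma quot_reprK : cancel quot_repr quot_pi.
Proof. by move=> x; rewrite /quot_pi /quot_repr reprK. Qed.

Lemma quot_piP x y : quot_pi x = quot_pi y <-> ideal_set I (x - y).
Proof.
split=> [/eqP|Ixy].
  by rewrite -Quotient.idealrBE => /ideal_predP.
by apply/eqP; rewrite -Quotient.idealrBE; apply/ideal_predP.
Qed.

Lemma quot_piD x y : quot_pi (x + y) = quot_pi x + quot_pi y.
Proof. exact: (raddfD (\pi_(Quotient.quot ideal_pred)%qT)). Qed.

Definition quot_one : quot_alg := quot_pi 1.
Definition quot_mul (x y : quot_alg) : quot_alg :=
  quot_pi (quot_repr x * quot_repr y).

Lemma quot_repr_pi x : ideal_set I (quot_repr (quot_pi x) - x).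
Proof. by apply/quot_piP; rewrite quot_reprK. Qed.

Lemma quot_piM x y : quot_mul (quot_pi x) (quot_pi y) = quot_pi (x * y).
Proof.
have [_ IB Il Ir] := idealP I; apply/quot_piP.
set x' := quot_repr _; set y' := quot_repr _.
have -> : x' * y' - x * y = (x' - x) * y' - x * (y - y').
  by rewrite mulrBl mulrBr opprB addrA subrK.
apply: IB; first exact/Ir/quot_repr_pi.
by apply: Il; apply/quot_piP; rewrite quot_reprK.
Qed.

Fact quot_mulA : associative quot_mul.
Proof.
move=> x y z; rewrite -[x]quot_reprK -[y]quot_reprK -[z]quot_reprK.
by rewrite !quot_piM mulrA.
Qed.

Fact quot_mul1 : left_id quot_one quot_mul.
Proof. by move=> x; rewrite -[x]quot_reprK quot_piM mul1r. Qed.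

Fact quot_mulr1 : right_id quot_one quot_mul.
Proof. by move=> x; rewrite -[x]quot_reprK quot_piM mulr1. Qed.

Fact quot_mulDl : left_distributive quot_mul +%R.
Proof.
move=> x y z; rewrite -[x]quot_reprK -[y]quot_reprK -[z]quot_reprK.
by rewrite -quot_piD !quot_piM -quot_piD mulrDl.
Qed.

Fact quot_mulDr : right_distributive quot_mul +%R.
Proof.
move=> x y z; rewrite -[x]quot_reprK -[y]quot_reprK -[z]quot_reprK.
by rewrite -quot_piD !quot_piM -quot_piD mulrDr.
Qed.

HB.instance Definition _ := GRing.Zmodule_isPzRing.Build quot_alg
  quot_mulA quot_mul1 quot_mulr1 quot_mulDl quot_mulDr.

Fact quot_pi_zmod : zmod_morphism quot_pi.
Proof. by move=> x y; exact: (raddfB (\pi_(Quotient.quot ideal_pred)%qT)). Qed.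

Fact quot_pi_monoid : monoid_morphism quot_pi.
Proof. by split=> // x y; rewrite -quot_piM. Qed.

HB.instance Definition _ :=
  GRing.isZmodMorphism.Build A quot_alg quot_pi quot_pi_zmod.
HB.instance Definition _ :=
  GRing.isMonoidMorphism.Build A quot_alg quot_pi quot_pi_monoid.

Fact quot_kmap_central (c : k) (x : quot_alg) :
  (quot_pi \o kmap) c * x = x * (quot_pi \o kmap) c.
Proof. by rewrite -[x]quot_reprK /= -!rmorphM kmap_central. Qed.

HB.instance Definition _ :=
  PzRing_isAlgebraOver.Build k quot_alg quot_kmap_central.

End QuotientAlgebra.

Record quiver := Quiver {
  vertex : finType;
  arrow : finType;
  src : arrow -> vertex;
  tgt : arrow -> vertex
}.

Section Paths.
Variable Q : quiver.

(* A path is a pair (v, w) of its source v and the word w of its arrows, written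
   from right to left: w = [:: a_n; ...; a_1] with src a_1 = v and
   src a_(i+1) = tgt a_i. The trivial path at v is (v, [::]). *)
Definition word_tgt (v : vertex Q) (w : seq (arrow Q)) : vertex Q :=
  if w is a :: _ then tgt a else v.

Fixpoint is_qpath (v : vertex Q) (w : seq (arrow Q)) : bool :=
  if w is a :: w' then (src a == word_tgt v w') && is_qpath v w' else true.

Record qpath := QPath {
  qpath_val : vertex Q * seq (arrow Q);
  _ : is_qpath qpath_val.1 qpath_val.2
}.

HB.instance Definition _ := [isSub for qpath_val].
HB.instance Definition _ := [Choice of qpath by <:].

Definition qsrc (p : qpath) : vertex Q := (val p).1.
Definition qword (p : qpath) : seq (arrow Q) := (val p).2.
Definition qtgt (p : qpath) : vertex Q := word_tgt (qsrc p) (qword p).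

Definition trivial_path (v : vertex Q) : qpath :=
  @QPath (v, [::]) isT.

Fact arrow_path_subproof (a : arrow Q) : is_qpath (src a) [:: a].
Proof. by rewrite /= eqxx. Qed.

Definition arrow_path (a : arrow Q) : qpath :=
  @QPath (src a, [:: a]) (arrow_path_subproof a).

(* The composite p q (first q, then p), when p starts where q ends; insub then
   never returns None (qcompP below). *)
Definition qcomp (p q : qpath) : option qpath :=
  if qsrc p == qtgt q then insub (qsrc q, qword p ++ qword q) else None.

Lemma qpathP (p : qpath) : is_qpath (qsrc p) (qword p).
Proof. exact: valP p. Qed.

Lemma qpath_eq (p q : qpath) : qsrc p = qsrc q -> qword p = qword q -> p = q.
Proof.
rewrite /qsrc /qword => e1 e2; apply: val_inj.
by rewrite [LHS]surjective_pairing e1 e2 -surjective_pairing.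
Qed.

Lemma word_tgt_cat v w1 w2 :
  word_tgt v (w1 ++ w2) = word_tgt (word_tgt v w2) w1.
Proof. by case: w1. Qed.

Lemma is_qpath_cat v w1 w2 :
  is_qpath v (w1 ++ w2) = is_qpath (word_tgt v w2) w1 && is_qpath v w2.
Proof. by elim: w1 => //= a w1 ->; rewrite word_tgt_cat andbA. Qed.

Variant qcomp_spec (p q : qpath) : option qpath -> Prop :=
| QcompSome r of qsrc p = qtgt q & qsrc r = qsrc q & qtgt r = qtgt p
    & qword r = qword p ++ qword q : qcomp_spec p q (Some r)
| QcompNone of qsrc p <> qtgt q : qcomp_spec p q None.

Lemma qcompP p q : qcomp_spec p q (qcomp p q).
Proof.
rewrite /qcomp; case: eqP => [e|]; last by constructor.
have ok : is_qpath (qsrc q) (qword p ++ qword q).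
  by rewrite is_qpath_cat -/(qtgt q) -e !qpathP.
case: insubP => [r _ er|]; last by rewrite ok.
have [es ew] : qsrc r = qsrc q /\ qword r = qword p ++ qword q.
  by rewrite /qsrc /qword er.
by constructor=> //; rewrite /qtgt es ew word_tgt_cat -/(qtgt q) -e.
Qed.

Lemma qcompA p q r :
  obind (qcomp p) (qcomp q r) = obind (qcomp^~ r) (qcomp p q).
Proof.
case: (qcompP q r) => [s e1 e2 e3 e4|ne1]; case: (qcompP p q) => [t f1 f2 f3 f4|ne2] //=.
- case: (qcompP p s) => [u g1 g2 g3 g4|]; last by rewrite e3.
  case: (qcompP t r) => [v h1 h2 h3 h4|]; last by rewrite f2.
  by congr Some; apply: qpath_eq; rewrite ?g2 ?h2 ?g4 ?h4 ?f4 ?e4 ?catA.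
- by case: (qcompP p s) => // u; rewrite e3.
- by case: (qcompP t r) => // u; rewrite f2.
Qed.

Lemma qcomp_triv_l v p :
  qcomp (trivial_path v) p = if v == qtgt p then Some p else None.
Proof.
case: (qcompP _ p) => [r e1 e2 _ e4|/eqP/negPf -> //].
by rewrite (introT eqP e1); congr Some; apply: qpath_eq.
Qed.

Lemma qcomp_triv_r v p :
  qcomp p (trivial_path v) = if v == qsrc p then Some p else None.
Proof.
case: (qcompP p _) => [r e1 e2 _ e4|/nesym/eqP/negPf -> //].
have e : qsrc p = v by rewrite e1.
rewrite -e eqxx; congr Some; apply: qpath_eq; first by rewrite e2 e.
by rewrite e4 cats0.
Qed.

End Paths.

Section PathAlgebra.
Variables (k : fieldType) (Q : quiver).

Definition path_alg : Type := {malg k[qpath Q]}.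

HB.instance Definition _ := GRing.Lmodule.copy path_alg {malg k[qpath Q]}.

Definition path_elt (p : qpath Q) : path_alg := << p >>.
Definition arrow_elt (a : arrow Q) : path_alg := path_elt (arrow_path a).

Definition qcomp_elt (p q : qpath Q) : path_alg :=
  if qcomp p q is Some r then path_elt r else 0.

Definition path_alg_one : path_alg :=
  \sum_(v : vertex Q) path_elt (trivial_path v).

Definition path_alg_mul (f g : path_alg) : path_alg :=
  \sum_(p <- msupp f) \sum_(q <- msupp g) (f@_p * g@_q) *: qcomp_elt p q.

Local Notation pmul := path_alg_mul.

Lemma path_algE (f : path_alg) :
  f = \sum_(p <- msupp f) f@_p *: path_elt p.
Proof.
rewrite [LHS]monalgE; apply: eq_bigr => p _.
by apply/malgP => q; rewrite mcoeffZ !mcoeffU mulr_natr.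
Qed.

Lemma path_alg_mulEw (d1 d2 : {fset qpath Q}) (f g : path_alg) :
  (msupp f `<=` d1)%fset -> (msupp g `<=` d2)%fset ->
  pmul f g = \sum_(p <- d1) \sum_(q <- d2) (f@_p * g@_q) *: qcomp_elt p q.
Proof.
move=> le1 le2; rewrite /pmul (big_fset_incl _ le1) /=.
  apply: eq_bigr => p _; apply: big_fset_incl => // q _ /mcoeff_outdom ->.
  by rewrite mulr0 scale0r.
move=> p _ /mcoeff_outdom fp.
by rewrite big1 // => q _; rewrite fp mul0r scale0r.
Qed.

Fact path_alg_mulDl : left_distributive pmul +%R.
Proof.
move=> f1 f2 g.
rewrite (path_alg_mulEw (msuppD_le f1 f2) (fsubset_refl _)).
rewrite (path_alg_mulEw (fsubsetUl _ (msupp f2)) (fsubset_refl (msupp g))).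
rewrite (path_alg_mulEw (fsubsetUr (msupp f1) _) (fsubset_refl (msupp g))).
rewrite -big_split /=; apply: eq_bigr => p _.
rewrite -big_split /=; apply: eq_bigr => q _.
by rewrite mcoeffD mulrDl scalerDl.
Qed.

Fact path_alg_mulDr : right_distributive pmul +%R.
Proof.
move=> f g1 g2.
rewrite (path_alg_mulEw (fsubset_refl _) (msuppD_le g1 g2)).
rewrite (path_alg_mulEw (fsubset_refl (msupp f)) (fsubsetUl _ (msupp g2))).
rewrite (path_alg_mulEw (fsubset_refl (msupp f)) (fsubsetUr (msupp g1) _)).
rewrite -big_split /=; apply: eq_bigr => p _.
rewrite -big_split /=; apply: eq_bigr => q _.
by rewrite mcoeffD mulrDr scalerDl.
Qed.

Fact path_alg_scaleAl (c : k) (f g : path_alg) :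
  c *: pmul f g = pmul (c *: f) g.
Proof.
rewrite [RHS](path_alg_mulEw (msuppZ_le c f) (fsubset_refl _)).
rewrite scaler_sumr; apply: eq_bigr => p _.
rewrite scaler_sumr; apply: eq_bigr => q _.
by rewrite scalerA mcoeffZ mulrA.
Qed.

Fact path_alg_scaleAr (c : k) (f g : path_alg) :
  c *: pmul f g = pmul f (c *: g).
Proof.
rewrite [RHS](path_alg_mulEw (fsubset_refl _) (msuppZ_le c g)).
rewrite scaler_sumr; apply: eq_bigr => p _.
rewrite scaler_sumr; apply: eq_bigr => q _.
by rewrite scalerA mcoeffZ mulrCA.
Qed.

Lemma path_alg_mul0l g : pmul 0 g = 0.
Proof. by rewrite /path_alg_mul msupp0 big_seq_fset0. Qed.

Lemma path_alg_mul0r f : pmul f 0 = 0.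
Proof.
by rewrite /path_alg_mul big1 // => p _; rewrite msupp0 big_seq_fset0.
Qed.

Lemma path_alg_mul_suml (J : Type) (r : seq J) (F : J -> path_alg) g :
  pmul (\sum_(i <- r) F i) g = \sum_(i <- r) pmul (F i) g.
Proof.
apply: (big_morph (pmul^~ g)) => [x y|]; first exact: path_alg_mulDl.
exact: path_alg_mul0l.
Qed.

Lemma path_alg_mul_sumr (J : Type) (r : seq J) (F : J -> path_alg) f :
  pmul f (\sum_(i <- r) F i) = \sum_(i <- r) pmul f (F i).
Proof.
apply: (big_morph (pmul f)) => [x y|]; first exact: path_alg_mulDr.
exact: path_alg_mul0r.
Qed.

Lemma path_elt_mul p q : pmul (path_elt p) (path_elt q) = qcomp_elt p q.
Proof.
rewrite (path_alg_mulEw msuppU_le msuppU_le) !big_seq_fset1.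
by rewrite !mcoeffUU mulr1 scale1r.
Qed.

Lemma path_elt_mulA p q r :
  pmul (path_elt p) (pmul (path_elt q) (path_elt r))
  = pmul (pmul (path_elt p) (path_elt q)) (path_elt r).
Proof.
rewrite (path_elt_mul q r) (path_elt_mul p q); have := qcompA p q r.
rewrite /qcomp_elt; case: (qcomp q r) => [s|]; case: (qcomp p q) => [t|] /= e.
- by rewrite (path_elt_mul p s) (path_elt_mul t r) /qcomp_elt e.
- by rewrite (path_elt_mul p s) path_alg_mul0l /qcomp_elt e.
- by rewrite (path_elt_mul t r) path_alg_mul0r /qcomp_elt -e.
- by rewrite path_alg_mul0l path_alg_mul0r.
Qed.

Lemma path_alg_mulZA (a b c : k) (f g h : path_alg) :
  pmul f (pmul g h) = pmul (pmul f g) h ->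
  pmul (a *: f) (pmul (b *: g) (c *: h))
  = pmul (pmul (a *: f) (b *: g)) (c *: h).
Proof.
move=> e; rewrite -[LHS]path_alg_scaleAl -[X in pmul f X]path_alg_scaleAl.
rewrite -[X in _ *: pmul f (_ *: X)]path_alg_scaleAr.
rewrite -[X in _ *: X]path_alg_scaleAr -[X in _ *: (_ *: X)]path_alg_scaleAr e.
rewrite -[RHS]path_alg_scaleAr -[X in _ = c *: pmul X h]path_alg_scaleAl.
rewrite -[X in _ = _ *: pmul (_ *: X) h]path_alg_scaleAr.
rewrite -[X in _ = _ *: X]path_alg_scaleAl -[X in _ = _ *: (_ *: X)]path_alg_scaleAl.
move: (pmul (pmul f g) h) => u.
by rewrite (scalerA b c) (scalerA a) (scalerA a b) (scalerA c) mulrA mulrC mulrA.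
Qed.

Fact path_alg_mulA : associative pmul.
Proof.
move=> f g h; rewrite (path_algE f) (path_algE g) (path_algE h).
rewrite [LHS]path_alg_mul_suml [X in _ = pmul X _]path_alg_mul_suml.
rewrite [RHS]path_alg_mul_suml; apply: eq_bigr => p _.
rewrite [X in pmul _ X = _]path_alg_mul_suml [LHS]path_alg_mul_sumr.
rewrite [X in _ = pmul X _]path_alg_mul_sumr [RHS]path_alg_mul_suml.
apply: eq_bigr => q _.
rewrite [X in pmul _ X = _]path_alg_mul_sumr [LHS]path_alg_mul_sumr.
rewrite [RHS]path_alg_mul_sumr; apply: eq_bigr => r _.
exact/path_alg_mulZA/path_elt_mulA.
Qed.

Fact path_alg_mul1l : left_id path_alg_one pmul.
Proof.
move=> f; rewrite [in LHS](path_algE f) path_alg_mul_sumr [RHS]path_algE.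
apply: eq_bigr => p _; rewrite -path_alg_scaleAr; congr (_ *: _).
rewrite path_alg_mul_suml (bigD1 (qtgt p)) //= big1 => [|v ne].
  by rewrite path_elt_mul /qcomp_elt qcomp_triv_l eqxx addr0.
by rewrite path_elt_mul /qcomp_elt qcomp_triv_l (negPf ne).
Qed.

Fact path_alg_mul1r : right_id path_alg_one pmul.
Proof.
move=> f; rewrite [in LHS](path_algE f) path_alg_mul_suml [RHS]path_algE.
apply: eq_bigr => p _; rewrite -path_alg_scaleAl; congr (_ *: _).
rewrite path_alg_mul_sumr (bigD1 (qsrc p)) //= big1 => [|v ne].
  by rewrite path_elt_mul /qcomp_elt qcomp_triv_r eqxx addr0.
by rewrite path_elt_mul /qcomp_elt qcomp_triv_r (negPf ne).
Qed.

HB.instance Definition _ := GRing.Zmodule_isPzRing.Build path_alg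
  path_alg_mulA path_alg_mul1l path_alg_mul1r path_alg_mulDl path_alg_mulDr.

Definition path_alg_kmap (c : k) : path_alg := c *: (1 : path_alg).

Fact path_alg_kmap_zmod : zmod_morphism path_alg_kmap.
Proof. by move=> c d; rewrite /path_alg_kmap scalerBl. Qed.

Fact path_alg_kmap_monoid : monoid_morphism path_alg_kmap.
Proof.
split=> [|c d]; rewrite /path_alg_kmap ?scale1r //.
by rewrite /*%R /= -path_alg_scaleAl path_alg_mul1l scalerA.
Qed.

HB.instance Definition _ :=
  GRing.isZmodMorphism.Build k path_alg path_alg_kmap path_alg_kmap_zmod.
HB.instance Definition _ :=
  GRing.isMonoidMorphism.Build k path_alg path_alg_kmap path_alg_kmap_monoid.

Fact path_alg_kmap_central (c : k) (f : path_alg) :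
  path_alg_kmap c * f = f * path_alg_kmap c.
Proof.
rewrite /path_alg_kmap /*%R /= -path_alg_scaleAl -path_alg_scaleAr.
by rewrite path_alg_mul1l path_alg_mul1r.
Qed.

HB.instance Definition _ :=
  PzRing_isAlgebraOver.Build k path_alg path_alg_kmap_central.

Definition arrow_ideal : set path_alg := ideal_gen (range arrow_elt).

Definition admissible (I : set path_alg) : Prop :=
  exists m : nat, [/\ (2 <= m)%N,
    ideal_exp arrow_ideal m `<=` I &
    I `<=` ideal_exp arrow_ideal 2].

End PathAlgebra.

Arguments path_elt {k Q}.
Arguments arrow_elt {k Q}.

Record mod_functor (A B : pzRingType) := ModFunctor {
  fobj :> lmodType A -> lmodType B;
  fmap : forall M N : lmodType A, {linear M -> N} -> {linear fobj M -> fobj N};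
  fmap_id : forall (M : lmodType A) (x : fobj M),
    fmap (idfun : {linear M -> M}) x = x;
  fmap_comp : forall (M N P : lmodType A)
      (g : {linear N -> P}) (f : {linear M -> N}) (x : fobj M),
    fmap (g \o f : {linear M -> P}) x = fmap g (fmap f x)
}.

(* F is k-linear on morphisms: F (c f + g) = c F f + F g, where c in k acts on a
   module through the scalar kmap c of the algebra. *)
Definition klinear_functor (k : comPzRingType) (A B : kalgType k)
    (F : mod_functor A B) : Prop :=
  forall (M N : lmodType A) (c : k) (f g h : {linear M -> N}),
    (forall x, h x = (kmap c : A) *: f x + g x) ->
    forall y, fmap F h y = (kmap c : B) *: fmap F f y + fmap F g y.

Definition left_quasi_inverse (A B : pzRingType)
    (F : mod_functor A B) (G : mod_functor B A) : Prop :=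
  exists eta : forall M : lmodType A, {linear G (F M) -> M},
    (forall M, bijective (eta M)) /\
    (forall (M N : lmodType A) (f : {linear M -> N}) (x : G (F M)),
       eta N (fmap G (fmap F f) x) = f (eta M x)).

Definition morita_equivalent (k : comPzRingType) (A B : kalgType k) : Prop :=
  exists (F : mod_functor A B) (G : mod_functor B A),
    [/\ klinear_functor F, klinear_functor G,
        left_quasi_inverse F G & left_quasi_inverse G F].

Definition at_most_one (T : Type) (P : T -> Prop) : Prop :=
  forall x y : T, P x -> P y -> x = y.

Definition biserial_quiver (Q : quiver) : Prop :=
  forall v : vertex Q,
    (#|[pred a : arrow Q | src a == v]| <= 2)%N /\
    (#|[pred a : arrow Q | tgt a == v]| <= 2)%N.

Definition non_single (Q : quiver) (a : arrow Q) : bool :=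
  [exists b : arrow Q, (b != a) && ((src b == src a) || (tgt b == tgt a))].

Section Conditions.
Variables (k : fieldType) (Q : quiver) (I : set (path_alg k Q)).

Definition extends_uniquely (x : path_alg k Q) : Prop :=
  at_most_one (fun b : arrow Q => ~ I (arrow_elt b * x)) /\
  at_most_one (fun c : arrow Q => ~ I (x * arrow_elt c)).

Definition arrows_extend_uniquely : Prop :=
  forall a : arrow Q, extends_uniquely (arrow_elt a).

Definition non_single_paths_extend_uniquely : Prop :=
  forall p : qpath Q, has (@non_single Q) (qword p) ->
    extends_uniquely (path_elt p).

End Conditions.

Section Classes.
Variables (k : fieldType) (A : kalgType k).

Definition special_biserial : Prop :=
  exists (Q : quiver) (I : ideal (path_alg k Q)),
    [/\ admissible I, morita_equivalent A (quot_alg I),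
        biserial_quiver Q & arrows_extend_uniquely I].

Definition special_multiserial : Prop :=
  exists (Q : quiver) (I : ideal (path_alg k Q)),
    [/\ admissible I, morita_equivalent A (quot_alg I)
      & arrows_extend_uniquely I].

Definition special_quasi_biserial : Prop :=
  exists (Q : quiver) (I : ideal (path_alg k Q)),
    [/\ admissible I, morita_equivalent A (quot_alg I),
        biserial_quiver Q & non_single_paths_extend_uniquely I].

End Classes.

(* Main.v *)
Require Import Defs.
From HB Require Import structures.
From mathcomp Require Import all_boot all_algebra.
From mathcomp Require Import boolp classical_sets monalg.

(** An algebra is special biserial as soon as it has an admissible presentation
    [kQ/I] in which every arrow extends uniquely on both sides and in which at
    most two arrows start and at most two arrows end at every vertex of [Q].
    The presentation that witnesses special multiseriality has the first
    property; the claim is that it has the second one too. The quiver of the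
    presentation that witnesses special quasi-biseriality has it, the two
    quotients are Morita equivalent, and the largest numbers of arrows starting,
    respectively ending, at a vertex are Morita invariants.

    Classically this holds because the quiver of a basic algebra is encoded in
    its module category: the number of arrows from [v] to [w] is the dimension
    of [Ext^1(S_v, S_w)]. The proof below extracts the two numbers more
    directly. A fan of size [n] is a module with a largest proper submodule,
    which is a direct sum of [n] nonzero modules; a cofan of size [n] is a
    module with an essential simple submodule, modulo which it contains a
    direct sum of [n] nonzero modules. Both are defined by morphisms only, so that linear
    equivalences of module categories preserve them ([morita_fan],
    [morita_cofan]). On the other hand, over [kQ/I] there is a fan, respectively
    a cofan, of size [n] exactly when at least [n] arrows start, respectively
    end, at some vertex of [Q] ([fanP], [cofanP]). The quiver condition thus
    says that there is neither a fan nor a cofan of size 3 ([biserial_quiverP]).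

    In [fanP] and [cofanP], the arrows give explicit modules of Loewy length 2,
    on which [kQ/I] acts through the coefficients at paths of length at most one
    because [I] lies in the square of the arrow ideal ([fan_of_arrows],
    [cofan_of_arrows]). Conversely, with fewer than [n] arrows at each vertex, a
    linear relation between the coefficients of these arrows contradicts the
    directness of the sum of [n] modules, by the nilpotence of the radical
    ([fan_arrows], [cofan_arrows]). These arguments are carried out in an
    arbitrary algebra with the relevant structure ([quiver_frame],
    [truncation]), which the quotients of path algebras have. *)

Set Implicit Arguments.
Unset Strict Implicit.
Unset Printing Implicit Defensive.

Import GRing.Theory.

Local Open Scope classical_set_scope.
Local Open Scope ring_scope.

(** * Quotient modules *)

Record submodule (R : pzRingType) (M : lmodType R) := Submodule {
  submod_set :> set M;
  submod0 : submod_set 0;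
  submodB : forall x y, submod_set x -> submod_set y -> submod_set (x - y);
  submodZ : forall a x, submod_set x -> submod_set (a *: x)
}.

Section QuotientModule.
Variables (R : pzRingType) (M : lmodType R) (N : submodule M).

Definition submod_pred : {pred M} := fun x => `[< submod_set N x >].

Fact submod_pred_zmod_closed : zmod_closed submod_pred.
Proof.
split=> [|x y /asboolP Nx /asboolP Ny]; first exact/asboolP/submod0.
exact/asboolP/submodB.
Qed.

HB.instance Definition _ :=
  GRing.isZmodClosed.Build M submod_pred submod_pred_zmod_closed.

(** Projections onto quotients turn cancellation properties of maps into
    statements on elements. *)
Definition quot_mod : Type := Quotient.quot submod_pred.
HB.instance Definition _ := GRing.Zmodule.on quot_mod.

Definition mod_pi (x : M) : quot_mod := \pi_(Quotient.quot submod_pred)%qT x.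
Definition mod_repr (x : quot_mod) : M :=
  (repr (x : Quotient.quot submod_pred))%qT.

Lemma mod_reprK : cancel mod_repr mod_pi.
Proof. by move=> x; rewrite /mod_pi /mod_repr reprK. Qed.

Lemma mod_piP x y : mod_pi x = mod_pi y <-> submod_set N (x - y).
Proof.
split=> [/eqP|Nxy]; first by rewrite -Quotient.idealrBE => /asboolP.
by apply/eqP; rewrite -Quotient.idealrBE; apply/asboolP.
Qed.

Fact mod_pi_zmod : zmod_morphism mod_pi.
Proof. by move=> x y; exact: (raddfB (\pi_(Quotient.quot submod_pred)%qT)). Qed.

HB.instance Definition _ :=
  GRing.isZmodMorphism.Build M quot_mod mod_pi mod_pi_zmod.

Definition mod_scale (a : R) (x : quot_mod) : quot_mod :=
  mod_pi (a *: mod_repr x).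

Lemma mod_pi_scale a x : mod_scale a (mod_pi x) = mod_pi (a *: x).
Proof.
apply/mod_piP; rewrite -scalerBr; apply: submodZ.
by apply/mod_piP; rewrite mod_reprK.
Qed.

Fact mod_scaleA a b x : mod_scale a (mod_scale b x) = mod_scale (a * b) x.
Proof. by rewrite -[x]mod_reprK !mod_pi_scale scalerA. Qed.

Fact mod_scale1 : left_id 1 mod_scale.
Proof. by move=> x; rewrite -[x]mod_reprK mod_pi_scale scale1r. Qed.

Fact mod_scaleDr : right_distributive mod_scale +%R.
Proof.
move=> a x y; rewrite -[x]mod_reprK -[y]mod_reprK -raddfD !mod_pi_scale.
by rewrite -raddfD scalerDr.
Qed.

Fact mod_scaleDl x : {morph mod_scale^~ x : a b / a + b}.
Proof.
by move=> a b; rewrite -[x]mod_reprK !mod_pi_scale -raddfD scalerDl.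
Qed.

HB.instance Definition _ := GRing.Zmodule_isLmodule.Build R quot_mod
  mod_scaleA mod_scale1 mod_scaleDr mod_scaleDl.

Fact mod_pi_scalable : scalable mod_pi.
Proof. by move=> a x; rewrite -[LHS]mod_pi_scale. Qed.

HB.instance Definition _ :=
  GRing.isScalable.Build R M quot_mod *:%R mod_pi mod_pi_scalable.

Definition quot_modT : lmodType R := quot_mod.
Definition quot_map : {linear M -> quot_modT} := mod_pi.

Lemma quot_map0 x : quot_map x = 0 <-> submod_set N x.
Proof. by rewrite -(raddf0 quot_map) mod_piP subr0. Qed.

End QuotientModule.

(** * Elements and linear maps *)

Section HomLemmas.
Variable R : pzRingType.

Definition linear_of (M N : lmodType R) (f : M -> N) (f_lin : linear f) :
    {linear M -> N} :=
  HB.pack_for {linear M -> N} f (GRing.isLinear.Build R M N *:%R f f_lin).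

Fact elt_map_linear (M : lmodType R) (m : M) :
  linear ((fun b : R => b *: m) : R^o -> M).
Proof. by move=> a x y; rewrite scalerDl scalerA. Qed.

(** Maps from the regular module are the elements of a module. They turn a
    condition on all maps into a module into a condition on its elements. *)
Definition elt_map (M : lmodType R) (m : M) : {linear R^o -> M} :=
  linear_of (elt_map_linear m).

Lemma sum_linear (J : finType) (X M : lmodType R) (T : J -> lmodType R)
    (f : forall i, {linear T i -> M}) (h : forall i, {linear X -> T i}) :
  exists u : {linear X -> M}, forall x, u x = \sum_i f i (h i x).
Proof.
suff f_lin : linear (fun x => \sum_i f i (h i x)) by exists (linear_of f_lin).
move=> a x y; rewrite scaler_sumr -big_split /=.
by apply: eq_bigr => i _; rewrite !linearP.
Qed.

End HomLemmas.

(** * Fans and cofans *)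

Section Invariants.
Variable R : pzRingType.
Implicit Types M N X Y S C : lmodType R.

Definition nonzero_map M N (f : {linear M -> N}) := exists x, f x <> 0.

(** Epimorphisms and monomorphisms are stated by cancellation, in the additive
    form that an additive functor visibly transports. *)
Definition epimorphic M N (f : {linear M -> N}) :=
  forall Y (u : {linear N -> Y}), (forall x, u (f x) = 0) -> forall y, u y = 0.

Definition monomorphic M N (f : {linear M -> N}) :=
  forall X (u : {linear X -> M}), (forall x, f (u x) = 0) -> forall x, u x = 0.

Definition jointly_monic n (T : 'I_n -> lmodType R) M
    (f : forall i, {linear T i -> M}) :=
  forall X (h : forall i, {linear X -> T i}),
    (forall x, \sum_i f i (h i x) = 0) -> forall i x, h i x = 0.

Definition jointly_kernel n (T : 'I_n -> lmodType R) M S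
    (f : forall i, {linear T i -> M}) (p : {linear M -> S}) :=
  (forall i x, p (f i x) = 0) /\
  forall X (h : {linear X -> M}), (forall x, p (h x) = 0) ->
    exists h' : forall i, {linear X -> T i},
      forall x, h x = \sum_i f i (h' i x).

Definition nonzero_mod M := exists x : M, x <> 0.

(** The conditions on [p] and [f] say that [M] has a largest proper
    submodule (the kernel of [p], since a map into [M] not killed by [p] is
    onto) and that this submodule is a direct sum of [n] nonzero modules. Over
    [kQ/I] this forces [M] to be a quotient of an indecomposable projective
    [P_v], and the number of summands cannot exceed the dimension of
    [rad P_v / rad^2 P_v], the number of arrows starting at [v]. The definition
    only speaks of morphisms, hence it is invariant under equivalences. *)
Definition fan n := exists M S (T : 'I_n -> lmodType R)
    (p : {linear M -> S}) (f : forall i, {linear T i -> M}),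
  [/\ nonzero_map p,
      forall X (h : {linear X -> M}), nonzero_map (p \o h) -> epimorphic h,
      jointly_monic f, jointly_kernel f p & forall i, nonzero_mod (T i)].

(** The dual notion: [S] is essential in [M], so that [M] has a simple socle,
    and the cokernel of [S] contains a direct sum of [n] nonzero modules. Over
    [kQ/I] the number [n] is bounded by the number of arrows ending at the
    vertex of the socle. *)
Definition cofan n := exists S M C (T : 'I_n -> lmodType R)
    (s : {linear S -> M}) (p : {linear M -> C})
    (f : forall i, {linear T i -> C}),
  [/\ nonzero_map s /\
      forall X (h : {linear M -> X}), nonzero_map (h \o s) -> monomorphic h,
      (forall x, p (s x) = 0) /\ epimorphic p,
      forall X (h : {linear M -> X}), (forall x, h (s x) = 0) ->
        exists h' : {linear C -> X}, forall x, h x = h' (p x),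
      jointly_monic f & forall i, nonzero_mod (T i)].

(** The projection onto the cokernel vanishes on the image. *)
Lemma epimorphic_surj M N (f : {linear M -> N}) :
  epimorphic f -> forall y, exists x, f x = y.
Proof.
move=> epi_f.
have im0 : exists x, f x = 0 by exists 0; rewrite raddf0.
have imB y z : (exists x, f x = y) -> (exists x, f x = z) ->
    exists x, f x = y - z.
  by move=> [x <-] [x' <-]; exists (x - x'); rewrite raddfB.
have imZ a y : (exists x, f x = y) -> exists x, f x = a *: y.
  by move=> [x <-]; exists (a *: x); rewrite linearZ.
pose im := @Submodule R N [set y | exists x, f x = y] im0 imB imZ.
move=> y; apply/(quot_map0 im y)/epi_f => x.
by apply/quot_map0; exists x.
Qed.

Lemma monomorphic_inj M N (f : {linear M -> N}) :
  monomorphic f -> forall x, f x = 0 -> x = 0.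
Proof.
move=> mono_f x fx0; rewrite -[x]scale1r; apply: (mono_f _ (elt_map x)) => b.
by rewrite /= linearZ /= fx0 scaler0.
Qed.

Lemma jointly_monic_inj n (T : 'I_n -> lmodType R) M
    (f : forall i, {linear T i -> M}) (x : forall i, T i) :
  jointly_monic f -> \sum_i f i (x i) = 0 -> forall i, x i = 0.
Proof.
move=> mono_f fx0 i; rewrite -[x i]scale1r.
apply: (mono_f _ (fun i => elt_map (x i))) => b.
transitivity ((b : R) *: \sum_j f j (x j)); last by rewrite fx0 scaler0.
by rewrite scaler_sumr; apply: eq_bigr => j _; rewrite /= linearZ.
Qed.

Lemma jointly_kernel_elt n (T : 'I_n -> lmodType R) M S
    (f : forall i, {linear T i -> M}) (p : {linear M -> S}) m :
  jointly_kernel f p -> p m = 0 ->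
  exists x : forall i, T i, m = \sum_i f i (x i).
Proof.
move=> [_ ker_f] pm0; have [|h hE] := ker_f _ (elt_map m).
  by move=> b; rewrite /= linearZ /= pm0 scaler0.
by exists (fun i => h i 1); rewrite -hE /= scale1r.
Qed.

End Invariants.

(** * Invariance under linear equivalences of module categories *)

Definition isomorphic (R : pzRingType) (M N : lmodType R) : Prop :=
  exists (f : {linear M -> N}) (g : {linear N -> M}), cancel f g /\ cancel g f.

Lemma bij_isomorphic (R : pzRingType) (M N : lmodType R) (f : {linear M -> N}) :
  bijective f -> exists g : {linear N -> M}, cancel f g /\ cancel g f.
Proof.
move=> [g0 fK g0K]; have g0_lin : linear g0.
  by move=> a x y; apply: (can_inj fK); rewrite linearP !g0K.
by exists (linear_of g0_lin).
Qed.

Section Additive.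
Variables (k : comPzRingType) (A B : kalgType k) (H : mod_functor A B).
Hypothesis H_lin : klinear_functor H.

(** Linearity with the scalar 0 shows that the value of the functor only
    depends on the graph of a linear map. *)
Lemma fmap_ext (M N : lmodType A) (f g : {linear M -> N}) :
  f =1 g -> fmap H f =1 fmap H g.
Proof.
move=> fg y; rewrite (H_lin (c := 0) (f := g) (g := g)); last first.
  by move=> x; rewrite fg rmorph0 scale0r add0r.
by rewrite rmorph0 scale0r add0r.
Qed.

Lemma fmapD (M N : lmodType A) (f g h : {linear M -> N}) :
  (forall x, h x = f x + g x) -> forall y, fmap H h y = fmap H f y + fmap H g y.
Proof.
move=> hE y; rewrite (H_lin (c := 1) (f := f) (g := g)); last first.
  by move=> x; rewrite hE rmorph1 scale1r.
by rewrite rmorph1 scale1r.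
Qed.

Lemma fmap0 (M N : lmodType A) (f : {linear M -> N}) :
  (forall x, f x = 0) -> forall y, fmap H f y = 0.
Proof.
move=> f0 y; apply: (addrI (fmap H f y)); rewrite addr0 -(@fmapD _ _ _ _ f) //.
by move=> x; rewrite f0 addr0.
Qed.

Lemma fmap_sum (M N : lmodType A) (J : Type) (r : seq J)
    (f : J -> {linear M -> N}) (h : {linear M -> N}) :
  (forall x, h x = \sum_(i <- r) f i x) ->
  forall y, fmap H h y = \sum_(i <- r) fmap H (f i) y.
Proof.
elim: r h => [|i r IHr] h hE y.
  by rewrite big_nil; apply: fmap0 => x; rewrite hE big_nil.
rewrite big_cons -(IHr (h \- f i)); last first.
  by move=> x; rewrite /= hE big_cons addrC addKr.
by apply: fmapD => x /=; rewrite addrC subrK.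
Qed.

Lemma fmap_compE (M N P : lmodType A) (g : {linear N -> P})
    (f : {linear M -> N}) (h : {linear M -> P}) :
  (forall x, h x = g (f x)) -> forall y, fmap H h y = fmap H g (fmap H f y).
Proof. by move=> hE y; rewrite -fmap_comp; apply: fmap_ext. Qed.

End Additive.

(** A natural isomorphism between the composite of [F] and [G] and the identity
    recovers a map from its image. *)
Lemma fmap_inj (k : comPzRingType) (A B : kalgType k) (F : mod_functor A B)
    (G : mod_functor B A) (M N : lmodType A) (f g : {linear M -> N}) :
  klinear_functor G -> left_quasi_inverse F G ->
  fmap F f =1 fmap F g -> f =1 g.
Proof.
move=> G_lin [eta [bij_eta nat_eta]] fg x.
have [eta' _ eta'K] := bij_eta M; rewrite -[x]eta'K -!nat_eta.
by rewrite (fmap_ext G_lin fg).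
Qed.

Section Transport.
Variables (k : comPzRingType) (A B : kalgType k).
Variables (F : mod_functor A B) (G : mod_functor B A).
Hypotheses (F_lin : klinear_functor F) (G_lin : klinear_functor G).
Hypotheses (GF : left_quasi_inverse F G) (FG : left_quasi_inverse G F).

Lemma fmap_faithful (M N : lmodType A) (f g : {linear M -> N}) :
  fmap F f =1 fmap F g -> f =1 g.
Proof. exact: fmap_inj G_lin GF. Qed.

Lemma fmap_eq0 (M N : lmodType A) (f : {linear M -> N}) :
  (forall y, fmap F f y = 0) -> forall x, f x = 0.
Proof.
move=> Ff0; apply: (@fmap_faithful _ _ f (GRing.null_fun N)) => y.
by rewrite Ff0 (fmap0 F_lin).
Qed.

(** The candidate is the conjugate of [G h] by the natural isomorphism; it is
    the right one because [G] is faithful. *)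
Lemma fmap_full (M N : lmodType A) (h : {linear F M -> F N}) :
  exists f : {linear M -> N}, fmap F f =1 h.
Proof.
have [eta [bij_eta nat_eta]] := GF.
have [e [etaK eK]] := bij_isomorphic (bij_eta M).
exists (eta N \o (fmap G h \o e)).
apply: (fmap_inj F_lin FG) => z.
have [eta' etaK' _] := bij_eta N; apply: (can_inj etaK').
by rewrite nat_eta /= etaK.
Qed.

Lemma ess_surj (X : lmodType B) : exists M : lmodType A, isomorphic (F M) X.
Proof.
have [eta [bij_eta _]] := FG; exists (G X), (eta X).
exact: bij_isomorphic.
Qed.

Lemma fmap_epimorphic (M N : lmodType A) (f : {linear M -> N}) :
  epimorphic f -> epimorphic (fmap F f).
Proof.
move=> epi_f Y u uf0; have [Y' [i [j [iK jK]]]] := ess_surj Y.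
have [u' u'E] := fmap_full (j \o u).
have u'f0 x : u' (f x) = 0.
  apply: (@fmap_eq0 _ _ (u' \o f)) => y.
  by rewrite fmap_comp u'E /= uf0 raddf0.
move=> y; apply: (can_inj jK); rewrite raddf0 -[LHS]/((j \o u) y) -u'E.
by apply: (fmap0 F_lin); exact: epi_f.
Qed.

Lemma fmap_monomorphic (M N : lmodType A) (f : {linear M -> N}) :
  monomorphic f -> monomorphic (fmap F f).
Proof.
move=> mono_f X u fu0; have [X' [i [j [iK jK]]]] := ess_surj X.
have [u' u'E] := fmap_full (u \o i).
have fu'0 x : f (u' x) = 0.
  apply: (@fmap_eq0 _ _ (f \o u')) => y.
  by rewrite fmap_comp u'E /= fu0.
move=> x; rewrite -[x]jK -[LHS]/((u \o i) (j x)) -u'E.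
by apply: (fmap0 F_lin); exact: mono_f.
Qed.

Lemma fmap_nonzero (M N : lmodType A) (f : {linear M -> N}) :
  nonzero_map f -> nonzero_map (fmap F f).
Proof.
move=> [x fx]; apply: contrapT => Ff0; apply: fx; apply: fmap_eq0 => y.
by apply: contrapT => fy; apply: Ff0; exists y.
Qed.

Lemma nonzero_of_fmap (M N : lmodType A) (f : {linear M -> N}) :
  nonzero_map (fmap F f) -> nonzero_map f.
Proof.
move=> [y fy]; apply: contrapT => f0; apply: fy; apply: (fmap0 F_lin) => x.
by apply: contrapT => fx; apply: f0; exists x.
Qed.

Lemma nonzero_mod_fmap (M : lmodType A) : nonzero_mod M -> nonzero_mod (F M).
Proof.
move=> [x x0]; have [|y yE] := @fmap_nonzero _ _ (idfun : {linear M -> M}).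
  by exists x.
by exists y; rewrite fmap_id in yE.
Qed.

Lemma fmap_jointly_monic n (T : 'I_n -> lmodType A) (M : lmodType A)
    (f : forall i, {linear T i -> M}) :
  jointly_monic f -> jointly_monic (fun i => fmap F (f i)).
Proof.
move=> mono_f X h fh0; have [X' [i [j [iK jK]]]] := ess_surj X.
pose h' l := sval (cid (fmap_full (h l \o i))).
have h'E l : fmap F (h' l) =1 h l \o i by rewrite /h'; case: cid.
have [u uE] := sum_linear f h'.
have u0 x : u x = 0.
  apply: fmap_eq0 => y.
  rewrite (fmap_sum F_lin (f := fun l => f l \o h' l) (r := index_enum _)) //.
  by rewrite -[RHS](fh0 (i y)); apply: eq_bigr => l _; rewrite fmap_comp h'E.
move=> l x; rewrite -[x]jK -[LHS]/((h l \o i) (j x)) -h'E.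
by apply: (fmap0 F_lin); apply: mono_f => z; rewrite -uE.
Qed.

Lemma fmap_jointly_kernel n (T : 'I_n -> lmodType A) (M S : lmodType A)
    (f : forall i, {linear T i -> M}) (p : {linear M -> S}) :
  jointly_kernel f p -> jointly_kernel (fun i => fmap F (f i)) (fmap F p).
Proof.
move=> [pf0 ker_f]; split=> [i y|X h ph0].
  by rewrite -fmap_comp; apply: (fmap0 F_lin) => x /=.
have [X' [i [j [iK jK]]]] := ess_surj X.
have [h' h'E] := fmap_full (h \o i).
have [|g gE] := ker_f _ h'.
  move=> x; apply: (@fmap_eq0 _ _ (p \o h')) => y.
  by rewrite fmap_comp h'E /= ph0.
exists (fun l => fmap F (g l) \o j) => x.
rewrite -[x in LHS]jK -[LHS]/((h \o i) (j x)) -h'E.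
rewrite (fmap_sum F_lin (f := fun l => f l \o g l) (r := index_enum _)) //.
by apply: eq_bigr => l _; rewrite fmap_comp.
Qed.

Lemma fmap_fan n : fan A n -> fan B n.
Proof.
move=> [M [S [T [p [f [p0 locM mono_f ker_f T0]]]]]].
exists (F M), (F S), (fun i => F (T i)), (fmap F p), (fun i => fmap F (f i)).
split; [exact: fmap_nonzero| |exact: fmap_jointly_monic
  |exact: fmap_jointly_kernel|by move=> i; apply: nonzero_mod_fmap].
move=> X h ph0; have [X' [i [j [iK jK]]]] := ess_surj X.
have [h' h'E] := fmap_full (h \o i).
have epi_h' : epimorphic h'.
  apply: locM; apply: nonzero_of_fmap; have [x hx] := ph0; exists (j x).
  by rewrite fmap_comp h'E /= jK.
move=> Y u uh0; apply: (fmap_epimorphic epi_h') => x.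
by rewrite h'E /= uh0.
Qed.

Lemma fmap_cofan n : cofan A n -> cofan B n.
Proof.
move=> [S [M [C [T [s [p [f [[s0 essM] [ps0 epi_p] coker_p mono_f T0]]]]]]]].
exists (F S), (F M), (F C), (fun i => F (T i)), (fmap F s), (fmap F p).
exists (fun i => fmap F (f i)).
split; [split; first exact: fmap_nonzero|split; last exact: fmap_epimorphic|
  |exact: fmap_jointly_monic|by move=> i; apply: nonzero_mod_fmap].
- move=> X h hs0; have [X' [i [j [iK jK]]]] := ess_surj X.
  have [h' h'E] := fmap_full (j \o h).
  have mono_h' : monomorphic h'.
    apply: essM; apply: nonzero_of_fmap; have [x hx] := hs0; exists x.
    rewrite fmap_comp h'E /= => /(congr1 i); rewrite jK raddf0; exact: hx.
  move=> Y u uh0; apply: (fmap_monomorphic mono_h') => x.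
  by rewrite h'E /= uh0 raddf0.
- by move=> y; rewrite -fmap_comp; apply: (fmap0 F_lin).
- move=> X h hs0; have [X' [i [j [iK jK]]]] := ess_surj X.
  have [h' h'E] := fmap_full (j \o h).
  have [|g gE] := coker_p _ h'.
    move=> x; apply: (@fmap_eq0 _ _ (h' \o s)) => y.
    by rewrite fmap_comp h'E /= hs0 raddf0.
  exists (i \o fmap F g) => x; apply: (can_inj jK).
  rewrite -[LHS]/((j \o h) x) -h'E /= iK.
  exact: fmap_compE.
Qed.

End Transport.

Lemma morita_fan (k : comPzRingType) (A B : kalgType k) n :
  morita_equivalent A B -> fan A n <-> fan B n.
Proof.
move=> [F [G [F_lin G_lin GF FG]]].
by split; [exact: (fmap_fan F_lin G_lin)|exact: (fmap_fan G_lin F_lin)].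
Qed.

Lemma morita_cofan (k : comPzRingType) (A B : kalgType k) n :
  morita_equivalent A B -> cofan A n <-> cofan B n.
Proof.
move=> [F [G [F_lin G_lin GF FG]]].
by split; [exact: (fmap_cofan F_lin G_lin)|exact: (fmap_cofan G_lin F_lin)].
Qed.

(** * Ideals of a ring and their powers *)

Section Ideals.
Variable R : pzRingType.
Implicit Types (S I J : set R) (x y : R).

Lemma ideal_gen_ideal S : is_ideal (ideal_gen S).
Proof.
split=> [|x y Ix Iy|a x Ix|a x Ix].
- by move=> K [[K0 _ _ _] _].
- move=> K KS; have [[_ KB _ _] _] := KS.
  by apply: KB; [exact: Ix|exact: Iy].
- by move=> K KS; have [[_ _ Kl _] _] := KS; apply: Kl; exact: Ix.
- by move=> K KS; have [[_ _ _ Kr] _] := KS; apply: Kr; exact: Ix.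
Qed.

Lemma ideal_gen_sub S : S `<=` ideal_gen S.
Proof. by move=> x Sx K [_]; apply. Qed.

Lemma ideal_gen_smallest S I : is_ideal I -> S `<=` I -> ideal_gen S `<=` I.
Proof. by move=> idI SI x; apply. Qed.

Lemma mem_ideal_mul I J x y : I x -> J y -> ideal_mul I J (x * y).
Proof. by move=> Ix Jy; apply: ideal_gen_sub; exists x, y. Qed.

Lemma ideal_exp_sub I n : is_ideal I -> ideal_exp I n.+1 `<=` I.
Proof.
move=> idI; apply: ideal_gen_smallest => // _ [x [y [Ix _ ->]]].
by have [_ _ _ Ir] := idI; apply: Ir.
Qed.

Lemma idealD I x y : is_ideal I -> I x -> I y -> I (x + y).
Proof.
move=> [I0 IB _ _] Ix Iy; rewrite -[y]opprK; apply: (IB) => //.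
by rewrite -[- y]add0r; apply: IB.
Qed.

Lemma ideal_sum I (J : Type) (r : seq J) (P : pred J) (f : J -> R) :
  is_ideal I -> (forall i, P i -> I (f i)) -> I (\sum_(i <- r | P i) f i).
Proof.
move=> idI If; apply: big_ind => //; first by case: idI.
by move=> x y; exact: idealD.
Qed.

End Ideals.

(** * Vertices, arrows and longer paths in the path algebra *)

Section PathAlgebra.
Variables (k : fieldType) (Q : quiver).
Local Notation kQ := (path_alg k Q).
Local Notation J := (@arrow_ideal k Q).
Implicit Types (x y : kQ) (a b : arrow Q) (v w : vertex Q).

Definition vertex_elt v : kQ := path_elt (trivial_path v).

Lemma scale_kmap (c : k) x : c *: x = kmap c * x.
Proof. by rewrite [RHS]/GRing.mul /= -path_alg_scaleAl path_alg_mul1l. Qed.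

Lemma scalerAl_path (c : k) x y : c *: (x * y) = (c *: x) * y.
Proof. exact: path_alg_scaleAl. Qed.

Lemma scalerAr_path (c : k) x y : c *: (x * y) = x * (c *: y).
Proof. exact: path_alg_scaleAr. Qed.

Lemma path_eltM p q : path_elt p * path_elt q = qcomp_elt k p q :> kQ.
Proof. exact: path_elt_mul. Qed.

Lemma sum_vertex_elt : \sum_v vertex_elt v = 1.
Proof. by []. Qed.

Lemma vertex_eltM v w :
  vertex_elt v * vertex_elt w = if v == w then vertex_elt v else 0.
Proof.
rewrite path_eltM /qcomp_elt qcomp_triv_l /qtgt /=.
by case: eqP => // ->.
Qed.

Lemma vertex_arrow v a :
  vertex_elt v * arrow_elt a = if v == tgt a then arrow_elt a else 0.
Proof. by rewrite path_eltM /qcomp_elt qcomp_triv_l; case: eqP. Qed.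

Lemma arrow_vertex a v :
  arrow_elt a * vertex_elt v = if v == src a then arrow_elt a else 0.
Proof. by rewrite path_eltM /qcomp_elt qcomp_triv_r; case: eqP. Qed.

Lemma path_elt_cons (p : qpath Q) a (w : seq (arrow Q)) : qword p = a :: w ->
  exists2 q, qword q = w & path_elt p = arrow_elt a * path_elt q :> kQ.
Proof.
move=> pE; have := qpathP p; rewrite pE /= => /andP[/eqP sa ok].
exists (@QPath Q (qsrc p, w) ok) => //.
rewrite path_eltM /qcomp_elt; case: qcompP => [r _ r_src _ r_word|].
  by congr path_elt; apply: qpath_eq; rewrite ?r_src ?r_word ?pE.
by rewrite /qsrc /= sa.
Qed.

(** Linear extension from paths. *)
Lemma path_alg_ind (P : kQ -> Prop) :
  P 0 -> (forall x y, P x -> P y -> P (x + y)) ->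
  (forall c x, P x -> P (c *: x)) -> (forall p, P (path_elt p)) ->
  forall x, P x.
Proof.
move=> P0 PD PZ Pp x; rewrite [x]path_algE.
by apply: big_ind => // p _; exact: PZ.
Qed.

Lemma arrow_ideal_ideal : is_ideal J.
Proof. exact: ideal_gen_ideal. Qed.

Lemma arrow_in_ideal a : J (arrow_elt a).
Proof. by apply: ideal_gen_sub; exists a. Qed.

Lemma ideal_exp1 x : J x -> ideal_exp J 1 x.
Proof. by move=> Jx; rewrite -[x]mulr1; apply: mem_ideal_mul. Qed.

Lemma ideal_expS x y n : J x -> ideal_exp J n y -> ideal_exp J n.+1 (x * y).
Proof. exact: mem_ideal_mul. Qed.

Lemma ideal_exp2_mul x y : J x -> J y -> ideal_exp J 2 (x * y).
Proof. by move=> Jx Jy; apply: ideal_expS => //; exact: ideal_exp1. Qed.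

Lemma ideal_expS_sub n : ideal_exp J n.+1 `<=` J.
Proof.
apply: ideal_gen_smallest; first exact: arrow_ideal_ideal.
by move=> _ [x [y [Jx _ ->]]]; have [_ _ _ Jr] := arrow_ideal_ideal; apply: Jr.
Qed.

(** The left ideal generated by the arrows. It turns out to be the two-sided
    ideal that they generate, see [arrow_ideal_comb]; this left-handed form
    lets an element of the radical act on a module one arrow at a time. *)
Definition arrow_comb x :=
  exists y : arrow Q -> kQ, x = \sum_a y a * arrow_elt a.

Lemma arrow_comb0 : arrow_comb 0.
Proof. by exists (fun=> 0); rewrite big1 // => a _; rewrite mul0r. Qed.

Lemma arrow_combB x y : arrow_comb x -> arrow_comb y -> arrow_comb (x - y).
Proof.
move=> [f ->] [g ->]; exists (fun a => f a - g a).
by rewrite -sumrB; apply: eq_bigr => a _; rewrite mulrBl.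
Qed.

Lemma arrow_combD x y : arrow_comb x -> arrow_comb y -> arrow_comb (x + y).
Proof.
move=> [f ->] [g ->]; exists (fun a => f a + g a).
by rewrite -big_split; apply: eq_bigr => a _; rewrite mulrDl.
Qed.

Lemma arrow_combM x y : arrow_comb y -> arrow_comb (x * y).
Proof.
move=> [f ->]; exists (fun a => x * f a).
by rewrite mulr_sumr; apply: eq_bigr => a _; rewrite mulrA.
Qed.

Lemma arrow_combZ (c : k) x : arrow_comb x -> arrow_comb (c *: x).
Proof. by rewrite scale_kmap; exact: arrow_combM. Qed.

Lemma arrow_comb_arrow a : arrow_comb (arrow_elt a).
Proof.
exists (fun b => if b == a then 1 else 0).
rewrite (bigD1 a) //= eqxx mul1r big1 ?addr0 // => b /negPf ->.
by rewrite mul0r.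
Qed.

Lemma arrow_comb_sum (T : Type) (r : seq T) (f : T -> kQ) :
  (forall i, arrow_comb (f i)) -> arrow_comb (\sum_(i <- r) f i).
Proof.
by move=> cf; apply: big_ind; [exact: arrow_comb0|exact: arrow_combD|].
Qed.

Lemma arrow_comb_vertices a (c : vertex Q -> k) :
  arrow_comb (arrow_elt a * \sum_v c v *: vertex_elt v).
Proof.
rewrite mulr_sumr; apply: arrow_comb_sum => v.
rewrite -scalerAr_path arrow_vertex; apply: arrow_combZ.
by case: ifP => _; [exact: arrow_comb_arrow|exact: arrow_comb0].
Qed.

(** A path of positive length has a rightmost arrow. *)
Lemma path_alg_decomp x : exists c : vertex Q -> k,
  arrow_comb (x - \sum_v c v *: vertex_elt v).
Proof.
elim/path_alg_ind: x => [|x y [c cx] [d dy]|e x [c cx]|p].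
- exists (fun=> 0); rewrite big1 ?subr0; first exact: arrow_comb0.
  by move=> v _; rewrite scale0r.
- exists (fun v => c v + d v).
  rewrite (_ : _ - _ = (x - \sum_v c v *: vertex_elt v)
                     + (y - \sum_v d v *: vertex_elt v)).
    exact: arrow_combD.
  rewrite addrACA -opprD -big_split; congr (_ - _).
  by apply: eq_bigr => v _; rewrite scalerDl.
- exists (fun v => e * c v).
  rewrite (_ : _ - _ = e *: (x - \sum_v c v *: vertex_elt v)).
    exact: arrow_combZ.
  rewrite scalerBr scaler_sumr; congr (_ - _).
  by apply: eq_bigr => v _; rewrite scalerA.
- move pE: (qword p) => w; elim: w p pE => [|a w IHw] p pE.
    exists (fun v => if v == qsrc p then 1 else 0).
    rewrite (bigD1 (qsrc p)) //= eqxx scale1r big1 ?addr0; last first.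
      by move=> v /negPf ->; rewrite scale0r.
    rewrite (_ : path_elt p = vertex_elt (qsrc p)).
      by rewrite subrr; exact: arrow_comb0.
    by congr path_elt; apply: qpath_eq.
  have [q qE ->] := path_elt_cons pE; have [c cq] := IHw q qE.
  exists (fun=> 0); rewrite [X in _ - X]big1 ?subr0; last first.
    by move=> v _; rewrite scale0r.
  rewrite -[path_elt q](subrK (\sum_v c v *: vertex_elt v)) mulrDr.
  by apply: arrow_combD; [exact: arrow_combM|exact: arrow_comb_vertices].
Qed.

(** The only question is closure under multiplication on the right by [z]; by
    [path_alg_decomp], [arrow_elt a * z] is a multiple of [arrow_elt a] plus
    another left combination of arrows. *)
Lemma arrow_ideal_comb x : J x -> arrow_comb x.
Proof.
apply: (@ideal_gen_smallest _ _ arrow_comb) => [|_ [a _ <-]]; last first.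
  exact: arrow_comb_arrow.
split; [exact: arrow_comb0|exact: arrow_combB|exact: arrow_combM|].
move=> z _ [y ->]; rewrite mulr_suml; apply: arrow_comb_sum => a.
rewrite -mulrA; apply: arrow_combM.
have [c cz] := path_alg_decomp z.
rewrite -[z](subrK (\sum_v c v *: vertex_elt v)) mulrDr.
by apply: arrow_combD; [exact: arrow_combM|exact: arrow_comb_vertices].
Qed.

Lemma arrow_comb_ideal x : arrow_comb x -> J x.
Proof.
move=> [y ->]; apply: ideal_sum => [|a _]; first exact: arrow_ideal_ideal.
by have [_ _ Jl _] := arrow_ideal_ideal; apply: Jl; exact: arrow_in_ideal.
Qed.

(** Applying [path_alg_decomp] to [x], then to the coefficients of the arrows,
    sorts the paths starting at [v] by length 0, 1 and at least 2. *)
Lemma vertex_decomp v x : exists (c : k) (d : arrow Q -> k) y,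
  ideal_exp J 2 y /\
  x * vertex_elt v
  = c *: vertex_elt v + \sum_(a | src a == v) d a *: arrow_elt a + y.
Proof.
have [c [y yE]] := path_alg_decomp x.
have /choice[c' c'E] a := path_alg_decomp (y a).
pose r a := y a - \sum_w c' a w *: vertex_elt w.
exists (c v), (fun a => c' a (tgt a)).
exists (\sum_(a | src a == v) r a * arrow_elt a).
split.
  apply: ideal_sum => [|a _]; first exact: ideal_gen_ideal.
  apply: ideal_exp2_mul; last exact: arrow_in_ideal.
  by apply: arrow_comb_ideal; exact: c'E.
rewrite -addrA -big_split /= -[x](subrK (\sum_v c v *: vertex_elt v)) yE.
rewrite mulrDl [LHS]addrC; congr (_ + _).
  rewrite mulr_suml (bigD1 v) //= big1 ?addr0.
    by rewrite -scalerAl_path vertex_eltM eqxx.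
  by move=> w /negPf w_v; rewrite -scalerAl_path vertex_eltM w_v scaler0.
rewrite mulr_suml [RHS]big_mkcond; apply: eq_bigr => a _.
rewrite -mulrA arrow_vertex eq_sym; case: ifP => _; last by rewrite mulr0.
rewrite -[y a in LHS](subrK (\sum_w c' a w *: vertex_elt w)) mulrDl addrC.
congr (_ + _); rewrite mulr_suml (bigD1 (tgt a)) //= big1 ?addr0.
  by rewrite -scalerAl_path vertex_arrow eqxx.
by move=> w /negPf w_v; rewrite -scalerAl_path vertex_arrow w_v scaler0.
Qed.

End PathAlgebra.

(** * Fans and cofans count arrows: the upper bound *)

(** More rows than columns: a nontrivial linear relation between the rows. *)
Lemma exists_left_null (K : fieldType) (T : finType) (P : pred T) n
    (d : 'I_n -> T -> K) : (#|P| < n)%N ->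
  exists l : 'I_n -> K, (exists i, l i != 0) /\
    forall a, P a -> \sum_i l i * d i a = 0.
Proof.
move=> ltPn; pose D := \matrix_(i < n, j < #|P|) d i (enum_val j).
have : kermx D != 0.
  rewrite -mxrank_eq0 mxrank_ker -lt0n subn_gt0.
  exact: leq_ltn_trans (rank_leq_col D) ltPn.
case/rowV0Pn => l /sub_kermxP lD l0; exists (fun i => l 0 i); split.
  apply: contrapT => nol; case/eqP: l0; apply/rowP => i; rewrite mxE.
  by apply/eqP/negPn/negP => li; apply: nol; exists i.
move=> a Pa; have /rowP/(_ (enum_rank_in Pa a)) := lD.
rewrite !mxE => lDa; rewrite -[RHS]lDa; apply: eq_bigr => i _.
by rewrite mxE enum_rankK_in.
Qed.

(** The features of an algebra [kQ/I] that bound its fans and cofans: the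
    classes of the vertices and of the arrows, and the nilpotent ideal [frad]
    that the arrows generate. *)
Record quiver_frame (k : fieldType) (Q : quiver) (B : kalgType k) :=
  QuiverFrame {
  fvert : vertex Q -> B;
  farrow : arrow Q -> B;
  frad : set B;
  frad_ideal : is_ideal frad;
  frad_nilpotent : exists N, forall x, ideal_exp frad N x -> x = 0;
  sum_fvert : \sum_v fvert v = 1;
  fvertK : forall v, fvert v * fvert v = fvert v;
  fvert_farrow : forall v a, tgt a != v -> fvert v * farrow a = 0;
  farrow_rad : forall a, frad (farrow a);
  frad_comb : forall x, frad x -> exists y, x = \sum_a y a * farrow a;
  fvert_decomp : forall v x, exists (c : k) (d : arrow Q -> k) y,
    ideal_exp frad 2 y /\
    x * fvert v = kmap c * fvert v
      + \sum_(a | src a == v) kmap (d a) * farrow a + y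
}.

Section Frame.
Variables (k : fieldType) (Q : quiver) (B : kalgType k) (R : quiver_frame Q B).
Local Notation J := (frad R).
Implicit Types (M N X : lmodType B) (x y : B) (a b : arrow Q) (v w : vertex Q).

Lemma fradMl x y : J y -> J (x * y).
Proof. by have [_ _ Jl _] := frad_ideal R; apply: Jl. Qed.

Lemma fradMr x y : J x -> J (x * y).
Proof. by have [_ _ _ Jr] := frad_ideal R; apply: Jr. Qed.

Lemma frad_exp n x : ideal_exp J n.+1 x -> J x.
Proof. by apply: ideal_exp_sub; exact: frad_ideal. Qed.

Lemma kscale_comm M (c : k) x (m : M) : x *: (kmap c *: m) = kmap c *: (x *: m).
Proof. by rewrite !scalerA kmap_central. Qed.

Lemma kscaleA M (c d : k) (m : M) :
  (kmap c : B) *: (kmap d *: m) = kmap (c * d) *: m.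
Proof. by rewrite scalerA rmorphM. Qed.

Lemma kscale0 M (m : M) : kmap (0 : k) *: m = 0.
Proof. by rewrite rmorph0 scale0r. Qed.

Lemma kscale1 M (m : M) : kmap (1 : k) *: m = m.
Proof. by rewrite rmorph1 scale1r. Qed.

Lemma kscaleK M (c : k) (m : M) :
  c != 0 -> (kmap c^-1 : B) *: (kmap c *: m) = m.
Proof. by move=> c0; rewrite kscaleA mulVf // kscale1. Qed.

Lemma kscale_eq0 M (c : k) (m : M) : c != 0 -> (kmap c : B) *: m = 0 -> m = 0.
Proof. by move=> c0 cm; rewrite -(kscaleK m c0) cm scaler0. Qed.

Lemma kscale_suml M (T : Type) (r : seq T) (P : pred T) (f : T -> k) (m : M) :
  (kmap (\sum_(i <- r | P i) f i) : B) *: m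
  = \sum_(i <- r | P i) kmap (f i) *: m.
Proof. by rewrite rmorph_sum scaler_suml. Qed.

Lemma linearZB M N (f : {linear M -> N}) x m : f (x *: m) = x *: f m.
Proof. exact: linearZ. Qed.

Lemma sum_fvert_scale M (m : M) : m = \sum_v fvert R v *: m.
Proof. by rewrite -scaler_suml sum_fvert scale1r. Qed.

Lemma fvert_scale_neq0 M (m : M) : m <> 0 -> exists v, fvert R v *: m <> 0.
Proof.
move=> m0; apply: contrapT => no; apply: m0.
rewrite [m]sum_fvert_scale big1 // => v _.
by apply: contrapT => mv; apply: no; exists v.
Qed.

Lemma fvert_scaleK M v (m : M) :
  fvert R v *: (fvert R v *: m) = fvert R v *: m.
Proof. by rewrite scalerA fvertK. Qed.

(** The sums of products [x *: m] with [x] in [K]; for an ideal [K], this is the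
    submodule [K M]. *)
Inductive span_of (K : set B) (M : lmodType B) : M -> Prop :=
| SpanOf0 : span_of K 0
| SpanOfD x m t of K x & span_of K t : span_of K (x *: m + t).

Definition rad M : set M := @span_of J M.

Lemma span_ofD K M (s t : M) : span_of K s -> span_of K t -> span_of K (s + t).
Proof.
move=> Ks Kt; elim: Ks => [|x m u Kx _ Ku]; first by rewrite add0r.
by rewrite -addrA; apply: SpanOfD.
Qed.

Lemma span_of_scale K K' M x (t : M) :
  (forall y, K y -> K' (x * y)) -> span_of K t -> span_of K' (x *: t).
Proof.
move=> KK'; elim=> [|y m u Ky _ Ku]; first by rewrite scaler0; exact: SpanOf0.
by rewrite scalerDr scalerA; apply: SpanOfD => //; apply: KK'.
Qed.

Lemma rad_scale M x (t : M) : rad t -> rad (x *: t).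
Proof. by apply: span_of_scale => y; exact: fradMl. Qed.

Lemma rad0 M : rad (0 : M). Proof. exact: SpanOf0. Qed.

Lemma radB M (s t : M) : rad s -> rad t -> rad (s - t).
Proof.
by move=> rs rt; apply: span_ofD => //; rewrite -scaleN1r; apply: rad_scale.
Qed.

Lemma rad_mem M x (t : M) : J x -> rad (x *: t).
Proof.
by move=> Jx; rewrite -[_ *: _]addr0; apply: SpanOfD => //; exact: rad0.
Qed.

(** If [J M = M] then [J^n M = M] for all [n], and [J] is nilpotent. *)
Lemma nakayama M : nonzero_mod M -> exists t : M, ~ rad t.
Proof.
move=> [m m0]; apply: contrapT => allrad.
have {}allrad (t : M) : rad t by apply: contrapT => nt; apply: allrad; exists t.
have radn n (t : M) : span_of (ideal_exp J n) t.
  elim: n t => [|n IHn] t.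
    by rewrite -[t]scale1r -[1 *: t]addr0; apply: SpanOfD => //; exact: SpanOf0.
  elim: (allrad t) => [|x u s Jx _ IHs]; first exact: SpanOf0.
  apply: span_ofD => //; apply: span_of_scale (IHn u) => y.
  exact: mem_ideal_mul.
have [N JN0] := frad_nilpotent R; apply: m0.
by elim: (radn N m) => // x u s /JN0 -> _ ->; rewrite scale0r addr0.
Qed.

(** Being killed by the radical amounts to lying in the socle. *)
Definition killed M (m : M) := forall y, J y -> y *: m = 0.

(** Multiply [t] by an element of the last power of the radical that does not
    kill it. *)
Lemma exists_killed M (t : M) :
  t <> 0 -> exists x, x *: t <> 0 /\ killed (x *: t).
Proof.
have [N JN0] := frad_nilpotent R.
have : forall x, ideal_exp J N x -> x *: t = 0.
  by move=> x /JN0 ->; rewrite scale0r.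
elim: N {JN0} => [|n IHn] Jnt t0; first by case: t0; rewrite -[t]scale1r Jnt.
have [/(IHn)/(_ t0) //|] := pselect (forall x, ideal_exp J n x -> x *: t = 0).
move=> /existsNP[x /not_implyP[Jx xt]]; exists x; split=> // y Jy.
by rewrite scalerA; apply: Jnt; exact: mem_ideal_mul.
Qed.

Lemma nilpotent_scale M x (m : M) : J x -> m = x *: m -> m = 0.
Proof.
move=> Jx mE; have [N JN0] := frad_nilpotent R.
have -> : m = x ^+ N *: m.
  by elim: (N) => [|n IHn]; rewrite ?expr0 ?scale1r // exprS -scalerA -IHn.
rewrite (JN0 (x ^+ N)) ?scale0r //.
by elim: (N) => [|n IHn]; rewrite ?expr0 // exprS; exact: mem_ideal_mul.
Qed.

(** [M] is generated by an element [m] supported at a vertex [v], and the kernel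
    of [p] is [J m], the direct sum of the [T i]. In each [T i] choose, by
    Nakayama, an element [t i] outside [J T i]. Modulo [J^2 m], which lies in
    the sum of the [J T i], each [f i (t i)] is a linear combination of the
    [a m] for the arrows [a] starting at [v]. With fewer than [n] such arrows
    there is a linear relation between the [t i] modulo the [J T i], which is
    absurd since the sum is direct. *)
Lemma fan_arrows n : fan B n ->
  exists v, (n <= #|[pred a : arrow Q | src a == v]|)%N.
Proof.
move=> [M [S [T [p [f [[m0 pm0] locM mono_f ker_f T0]]]]]].
have [v pv] := fvert_scale_neq0 pm0; pose m := fvert R v *: m0.
have evm : fvert R v *: m = m by rewrite fvert_scaleK.
have pm : p m <> 0 by rewrite linearZB.
have gen (u : M) : p u <> 0 -> forall y : M, exists x, y = x *: u.
  move=> pu y; have [|b bE] := epimorphic_surj (locM _ (elt_map u) _) y.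
    by exists 1; rewrite /= scale1r.
  by exists b.
have pJm x : J x -> p (x *: m) = 0.
  move=> Jx; apply: contrapT => pxm; have [y yE] := gen _ pxm m.
  apply: pm; rewrite (@nilpotent_scale _ (y * x) m) ?raddf0 -?scalerA //.
  exact: fradMl.
(* J^2 m lies in the sum of the J T i because J m lies in the sum of the T i;
   the factor b makes the condition a two-sided ideal. *)
have J2m y : ideal_exp J 2 y ->
    exists t : forall i, T i,
      (forall i, rad (t i)) /\ y *: m = \sum_i f i (t i).
  pose K z := forall b : B, exists t : forall i, T i,
    (forall i, rad (t i)) /\ (z * b) *: m = \sum_i f i (t i).
  suff KJ : ideal_exp J 2 `<=` K by move=> /KJ /(_ 1); rewrite mulr1.
  apply: ideal_gen_smallest => [|_ [x [z [Jx Jz ->]]] b].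
    split=> [b|x z Kx Kz b|b x Kx c|b x Kx c].
    - exists (fun=> 0); split=> [i|]; first exact: rad0.
      by rewrite mul0r scale0r big1 // => i _; rewrite raddf0.
    - have [t [rt tE]] := Kx b; have [s [rs sE]] := Kz b.
      exists (fun i => t i - s i); split=> [i|]; first exact: radB.
      rewrite mulrBl scalerBl tE sE -sumrB; apply: eq_bigr => i _.
      by rewrite raddfB.
    - have [t [rt tE]] := Kx c; exists (fun i => b *: t i).
      split=> [i|]; first exact: rad_scale.
      rewrite -mulrA -scalerA tE scaler_sumr; apply: eq_bigr => i _.
      by rewrite linearZB.
    - by rewrite -mulrA; apply: Kx.
  have Jzb : J (z * b) by apply: fradMr; exact: (@frad_exp 0%N).
  have [t tE] := jointly_kernel_elt ker_f (pJm _ Jzb).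
  exists (fun i => x *: t i); split=> [i|]; first exact: rad_mem.
  rewrite -mulrA -scalerA tE scaler_sumr; apply: eq_bigr => i _.
  by rewrite linearZB.
exists v; rewrite leqNgt; apply/negP => few.
pose t i := sval (cid (nakayama (T0 i))).
have tN i : ~ rad (t i) by rewrite /t; case: cid.
have coef i : exists (d : arrow Q -> k) y, ideal_exp J 2 y /\
    f i (t i) = \sum_(a | src a == v) kmap (d a) *: (farrow R a *: m) + y *: m.
  have [x xE] := gen m pm (f i (t i)).
  have [c [d [y [Jy xvE]]]] := fvert_decomp R v x.
  have ftE : f i (t i) = kmap c *: m
      + \sum_(a | src a == v) kmap (d a) *: (farrow R a *: m) + y *: m.
    rewrite xE -[in LHS]evm scalerA xvE !scalerDl -scalerA evm scaler_suml.
    by under eq_bigr => a _ do rewrite -scalerA.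
  exists d, y; split=> //; rewrite ftE.
  (* f i (t i) is killed by p, and m is not. *)
  have [-> |c0] := eqVneq c 0; first by rewrite kscale0 add0r.
  have := ker_f.1 i (t i); rewrite ftE !raddfD /= raddf_sum big1 ?addr0.
    rewrite (pJm y) ?addr0; last exact: frad_exp Jy.
    by rewrite linearZB => /(kscale_eq0 c0).
  move=> a _ /=; rewrite linearZB pJm ?scaler0 //; exact: farrow_rad.
have /choice[d /choice[y yE]] := coef.
have [l [[i0 li0] lE]] := exists_left_null d few.
have Jy : ideal_exp J 2 (\sum_i kmap (l i) * y i).
  apply: ideal_sum => [|i _]; first exact: ideal_gen_ideal.
  have [_ _ Jl _] : is_ideal (ideal_exp J 2) by exact: ideal_gen_ideal.
  by apply: Jl; case: (yE i).
have [s [rs sE]] := J2m _ Jy.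
have : \sum_i f i (kmap (l i) *: t i - s i) = 0.
  transitivity (\sum_i kmap (l i) *: f i (t i)
    - (\sum_i kmap (l i) * y i) *: m).
    by rewrite sE -sumrB; apply: eq_bigr => i _; rewrite raddfB /= linearZB.
  rewrite scaler_suml -sumrB.
  transitivity (\sum_i \sum_(a | src a == v)
      kmap (l i * d i a) *: (farrow R a *: m)).
    apply: eq_bigr => i _; have [_ ->] := yE i.
    rewrite scalerDr scalerA addrK scaler_sumr.
    by apply: eq_bigr => a _; rewrite kscaleA.
  rewrite exchange_big big1 //= => a sa.
  by rewrite -kscale_suml lE // kscale0.
move=> /(jointly_monic_inj mono_f) /(_ i0) /eqP; rewrite subr_eq0 => /eqP ltE.
by apply: (tN i0); rewrite -(kscaleK (t i0) li0) ltE; apply: rad_scale.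
Qed.

(** On an element supported at one vertex and killed by the radical, the algebra
    acts by scalars, so that the line it spans is a submodule. *)
Lemma killed_scale M v x (m : M) :
  fvert R v *: m = m -> killed m -> exists c : k, x *: m = kmap c *: m.
Proof.
move=> evm Jm; have [c [d [y [Jy xvE]]]] := fvert_decomp R v x; exists c.
rewrite -[in LHS]evm scalerA xvE !scalerDl -scalerA evm scaler_suml big1 ?addr0.
  by rewrite (Jm y) ?addr0 //; exact: frad_exp Jy.
by move=> a _; rewrite -scalerA Jm ?scaler0 //; exact: farrow_rad.
Qed.

Lemma line_submodule M v (m : M) : fvert R v *: m = m -> killed m ->
  exists N : submodule M,
    forall u, submod_set N u <-> exists c : k, u = kmap c *: m.
Proof.
move=> evm Jm; pose L (u : M) := exists c : k, u = kmap c *: m.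
have L0 : L 0 by exists 0; rewrite kscale0.
have LB (x y : M) : L x -> L y -> L (x - y).
  by move=> [c ->] [d ->]; exists (c - d); rewrite rmorphB scalerBl.
have LZ (b : B) (x : M) : L x -> L (b *: x).
  move=> [c ->]; rewrite kscale_comm; have [d ->] := killed_scale b evm Jm.
  by exists (c * d); rewrite kscaleA.
by exists (@Submodule B M L L0 LB LZ).
Qed.

(** The line of an element at a vertex killed by the radical is a submodule; it
    contains the image of [s], because otherwise the projection of [M] modulo
    this line would be monic. Hence all these lines are equal, to the line of
    [m0] say, supported at a vertex [v], and this line is the kernel of [p].
    Choose nonzero socle elements [t i] in the [T i] and lift the [f i (t i)] to
    elements [m i] of [M]. Every arrow sends [m i] to a multiple of [m0], which
    vanishes unless the arrow ends at [v]. With fewer than [n] arrows ending at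
    [v], some nontrivial combination of the [m i] is killed by all arrows, hence
    lies on the line of [m0] and vanishes under [p]; as the [f i] are jointly
    monic this contradicts [t i <> 0]. *)
Lemma cofan_arrows n : cofan B n ->
  exists v, (n <= #|[pred a : arrow Q | tgt a == v]|)%N.
Proof.
move=> [S [M [C [T [s [p [f [[s0 essM] [ps0 epi_p] coker_p mono_f T0]]]]]]]].
have [u0 su0] := s0.
have [z [zu Jzu]] := exists_killed su0.
have [v vzu] := fvert_scale_neq0 zu.
pose m0 := fvert R v *: (z *: s u0).
have m0E : m0 = s (fvert R v *: (z *: u0)) by rewrite !linearZB.
have evm0 : fvert R v *: m0 = m0 by rewrite fvert_scaleK.
have killed_fvert w (M' : lmodType B) (m : M') :
    killed m -> killed (fvert R w *: m).
  by move=> Jm y Jy; rewrite scalerA; apply: Jm; exact: fradMr.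
have Jm0 : killed m0 by exact: killed_fvert.
have [L LE] := line_submodule evm0 Jm0.
have im_s w (m : M) : fvert R w *: m = m -> killed m -> m <> 0 ->
    forall u, exists c : k, s u = kmap c *: m.
  move=> ewm Jm mn0 u; have [N NE] := line_submodule ewm Jm.
  apply: contrapT => nsu; apply: mn0.
  apply: (monomorphic_inj (f := quot_map N)).
    by apply: essM; exists u => /quot_map0 /NE.
  by apply/quot_map0/NE; exists 1; rewrite kscale1.
have ker_p (m : M) : p m = 0 -> submod_set L m.
  move=> pm; have [|h hE] := coker_p _ (quot_map L).
    by move=> u; apply/quot_map0/LE; exact: (im_s v).
  by apply/quot_map0; rewrite hE pm raddf0.
have pL (m : M) : submod_set L m -> p m = 0.
  by move=> /LE[c ->]; rewrite linearZB m0E ps0 scaler0.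
have socL (m : M) : killed m -> submod_set L m.
  move=> Jm; rewrite [m]sum_fvert_scale; apply/quot_map0.
  rewrite raddf_sum big1 // => w _; apply/quot_map0/LE.
  have [-> |/eqP ewm0] := eqVneq (fvert R w *: m) 0.
    by exists 0; rewrite kscale0.
  have [c cE] := im_s w _ (fvert_scaleK w m) (@killed_fvert w _ m Jm) ewm0
    (fvert R v *: (z *: u0)).
  rewrite m0E cE; have [c0|c0] := eqVneq c 0.
    by case: vzu; rewrite -[LHS]/m0 m0E cE c0 kscale0.
  by exists c^-1; rewrite kscaleK.
exists v; rewrite leqNgt; apply/negP => few.
have socT i : exists t : T i, t <> 0 /\ killed t.
  by have [x /exists_killed[y [yx Jyx]]] := T0 i; exists (y *: x).
pose t i := sval (cid (socT i)).
have tE i : t i <> 0 /\ killed (t i) by rewrite /t; case: cid.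
have /choice[m mE] i := epimorphic_surj epi_p (f i (t i)).
have aL a i : submod_set L (farrow R a *: m i).
  apply: ker_p; rewrite linearZB mE -linearZB (tE i).2 ?raddf0 //.
  exact: farrow_rad.
have /choice[d dE] i : exists d : arrow Q -> k, forall a,
    farrow R a *: m i = kmap (d a) *: m0.
  have /choice[e eE] a : exists c : k, farrow R a *: m i = kmap c *: m0.
    exact/LE.
  by exists e.
have [l [[i0 li0] lE]] := exists_left_null d few.
pose m1 := \sum_i (kmap (l i) : B) *: m i.
have am1 a : farrow R a *: m1 = 0.
  have -> : farrow R a *: m1 = kmap (\sum_i l i * d i a) *: m0.
    rewrite scaler_sumr kscale_suml; apply: eq_bigr => i _.
    by rewrite kscale_comm dE kscaleA.
  have [ta|ta] := eqVneq (tgt a) v; first by rewrite lE ?kscale0 //; apply/eqP.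
  rewrite big1 ?kscale0 // => i _; apply/eqP/negPn/negP => ld0.
  have di0 : d i a != 0 by apply: contraNneq ld0 => ->; rewrite mulr0.
  have : kmap (d i a) *: m0 = 0.
    by rewrite -evm0 -kscale_comm -dE scalerA fvert_farrow // scale0r.
  by move=> /(kscale_eq0 di0) m00; case: vzu.
have Jm1 : killed m1.
  move=> x /frad_comb[y ->]; rewrite scaler_suml big1 // => a _.
  by rewrite -scalerA am1 scaler0.
have : \sum_i f i (kmap (l i) *: t i) = 0.
  rewrite -[RHS](pL _ (socL _ Jm1)) raddf_sum; apply: eq_bigr => i _ /=.
  by rewrite !linearZB mE.
move=> /(jointly_monic_inj mono_f) /(_ i0) /(kscale_eq0 li0).
by have [] := tE i0.
Qed.

End Frame.

(** * Coefficients at the paths of length at most one *)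

Section Coefficients.
Variables (k : fieldType) (Q : quiver).
Local Notation kQ := (path_alg k Q).
Local Notation J := (@arrow_ideal k Q).
Implicit Types (x y : kQ) (a b : arrow Q) (v w : vertex Q) (p q : qpath Q).

Definition pcoef p : kQ -> k := mcoeff p.
Local Notation vcoef v := (pcoef (trivial_path v)).
Local Notation acoef a := (pcoef (arrow_path a)).

Lemma pcoefD p x y : pcoef p (x + y) = pcoef p x + pcoef p y.
Proof. exact: mcoeffD. Qed.

Lemma pcoefB p x y : pcoef p (x - y) = pcoef p x - pcoef p y.
Proof. exact: mcoeffB. Qed.

Lemma pcoef_sum p (T : Type) (r : seq T) (f : T -> kQ) :
  pcoef p (\sum_(i <- r) f i) = \sum_(i <- r) pcoef p (f i).
Proof. exact: (raddf_sum (mcoeff p)). Qed.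

Lemma pcoefZ p c x : pcoef p (c *: x) = c * pcoef p x.
Proof. exact: mcoeffZ. Qed.

Lemma pcoef0 p : pcoef p 0 = 0.
Proof. exact: mcoeff0. Qed.

Lemma pcoef_path p q : pcoef q (path_elt p) = (p == q)%:R.
Proof. by rewrite /pcoef mcoeffU. Qed.

Lemma pcoef_pathM p q r : pcoef r (path_elt p * path_elt q)
  = if qcomp p q is Some s then (s == r)%:R else 0.
Proof.
rewrite path_eltM /qcomp_elt.
by case: (qcomp p q) => [s|]; [exact: pcoef_path|exact: pcoef0].
Qed.

Lemma mul_coef_path p q p' q' : pcoef p' (path_elt p) * pcoef q' (path_elt q)
  = ((p == p') && (q == q'))%:R.
Proof. by rewrite -mulnb natrM; congr (_ * _); exact: pcoef_path. Qed.

(** The product formulas below compare two bilinear forms on [kQ], which only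
    have to be compared on paths. *)
Definition bilinear_form (F : kQ -> kQ -> k) : Prop :=
  (forall c x x' y, F (c *: x + x') y = c * F x y + F x' y) /\
  (forall c x y y', F x (c *: y + y') = c * F x y + F x y').

Lemma bilinear_form_ext (F G : kQ -> kQ -> k) :
  bilinear_form F -> bilinear_form G ->
  (forall p q, F (path_elt p) (path_elt q) = G (path_elt p) (path_elt q)) ->
  forall x y, F x y = G x y.
Proof.
move=> [Fl Fr] [Gl Gr] FG x y.
have ind (P : kQ -> Prop) : (forall c x x', P x -> P x' -> P (c *: x + x')) ->
    (forall p, P (path_elt p)) -> P 0 -> forall z, P z.
  move=> Plin Ppath P0; elim/path_alg_ind => // [z z' Pz Pz'|c z Pz].
    by rewrite -[z]scale1r; apply: Plin.
  by rewrite -[c *: z]addr0; apply: Plin.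
have F0l z : F 0 z = 0.
  by have := Fl (-1) 0 0 z; rewrite scaler0 addr0 mulN1r addNr.
have G0l z : G 0 z = 0.
  by have := Gl (-1) 0 0 z; rewrite scaler0 addr0 mulN1r addNr.
have F0r z : F z 0 = 0.
  by have := Fr (-1) z 0 0; rewrite scaler0 addr0 mulN1r addNr.
have G0r z : G z 0 = 0.
  by have := Gr (-1) z 0 0; rewrite scaler0 addr0 mulN1r addNr.
elim/ind: x => [c x x' xE x'E|p|].
- by rewrite Fl Gl xE x'E.
- elim/ind: y => [c y y' yE y'E|q|]; [by rewrite Fr Gr yE y'E|exact: FG|].
  by rewrite F0r G0r.
- by rewrite F0l G0l.
Qed.

Lemma bilinear_coefM p : bilinear_form (fun x y => pcoef p (x * y)).
Proof.
split=> [c x x' y|c x y y'].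
  by rewrite mulrDl pcoefD -scalerAl_path pcoefZ.
by rewrite mulrDr pcoefD -scalerAr_path pcoefZ.
Qed.

Lemma bilinear_coef_coef p q : bilinear_form (fun x y => pcoef p x * pcoef q y).
Proof.
split=> [c x x' y|c x y y']; rewrite pcoefD pcoefZ.
  by rewrite mulrDl mulrA.
by rewrite mulrDr mulrCA.
Qed.

Lemma bilinear_formD F G : bilinear_form F -> bilinear_form G ->
  bilinear_form (fun x y => F x y + G x y).
Proof.
move=> [Fl Fr] [Gl Gr]; split=> [c x x' y|c x y y'].
  by rewrite Fl Gl mulrDr addrACA.
by rewrite Fr Gr mulrDr addrACA.
Qed.

Lemma eq_trivial_path p v :
  (p == trivial_path v) = (qsrc p == v) && nilp (qword p).
Proof.
apply/eqP/andP => [->|[/eqP ps /nilP pw]]; first by rewrite /qsrc /= eqxx.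
exact: qpath_eq.
Qed.

Lemma eq_arrow_path p a : (p == arrow_path a) = (qword p == [:: a]).
Proof.
apply/eqP/eqP => [-> //|pw]; apply: qpath_eq => //.
by have := qpathP p; rewrite pw /= andbT => /eqP.
Qed.

(** A composite path is trivial only if both factors are. *)
Lemma vcoefM v x y : vcoef v (x * y) = vcoef v x * vcoef v y.
Proof.
move: x y; apply: bilinear_form_ext => [||p q];
  [exact: bilinear_coefM|exact: bilinear_coef_coef|].
rewrite (pcoef_pathM p q) (mul_coef_path p q) !eq_trivial_path.
case: qcompP => [r pq r_src _ r_word|pq].
  rewrite eq_trivial_path r_src r_word pq /qtgt.
  case: (qword q) => [|b u] /=; first by rewrite cats0 andbT andbAC andbb.
  by rewrite !andbF /nilp size_cat addnS andbF.
rewrite (_ : _ && _ = false) //; apply/negbTE/negP.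
move=> /andP[/andP[/eqP ps _] /andP[/eqP qs /nilP qw]]; case: pq.
by rewrite /qtgt qw ps.
Qed.

(** A path of length one factors only through its trivial endpoints. *)
Lemma acoefM a x y :
  acoef a (x * y) = vcoef (tgt a) x * acoef a y + acoef a x * vcoef (src a) y.
Proof.
move: x y; apply: bilinear_form_ext => [||p q]; first exact: bilinear_coefM.
  by apply: bilinear_formD; exact: bilinear_coef_coef.
rewrite (pcoef_pathM p q) !(mul_coef_path p q) -natrD.
rewrite !eq_trivial_path !eq_arrow_path.
case: qcompP => [r pq r_src _ r_word|pq].
  rewrite eq_arrow_path r_word pq /qtgt.
  case qw: (qword q) => [|b u] /=.
    rewrite cats0 andbF add0n andbT.
    case: eqP => [pw|_] /=; last by rewrite ?andFb.
    have := qpathP p; rewrite pw /= andbT pq /qtgt qw /= eq_sym => /eqP <-.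
    by rewrite eqxx.
  rewrite !andbF addn0.
  case pw: (qword p) => [|c [|d u']] /=.
  - rewrite andbT; case: eqP => [[-> _]|_]; rewrite ?andbF //.
    by rewrite eqxx.
  - by rewrite !andbF eqseq_cons andbF.
  - by rewrite !andbF eqseq_cons andbF.
case: (qword q =P [:: a]) => [qw|_]; last first.
  rewrite andbF add0n; case: (qword p =P [:: a]) => [pw|_] //=.
  case: eqP => //= qs; case: nilP => //= qw; case: pq.
  have := qpathP p; rewrite pw /= andbT => /eqP <-.
  by rewrite /qtgt qw.
rewrite qw /= !andbF andbT addn0; case: eqP => //= ps; case: pq.
by rewrite /qtgt qw.
Qed.

Lemma vcoef_vertex v w : vcoef v (vertex_elt k w) = (w == v)%:R.
Proof. by rewrite pcoef_path eq_trivial_path andbT. Qed.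

Lemma vcoef_arrow v a : vcoef v (arrow_elt a) = 0.
Proof. by rewrite pcoef_path eq_trivial_path andbF. Qed.

Lemma acoef_vertex a v : acoef a (vertex_elt k v) = 0.
Proof. by rewrite pcoef_path eq_arrow_path. Qed.

Lemma acoef_arrow a b : acoef a (arrow_elt b) = (b == a)%:R.
Proof. by rewrite pcoef_path eq_arrow_path eqseq_cons andbT. Qed.

Lemma vcoef1 v : vcoef v 1 = 1.
Proof.
rewrite -sum_vertex_elt pcoef_sum (bigD1 v) //= big1 ?addr0.
  by rewrite vcoef_vertex eqxx.
by move=> w /negPf wv; rewrite vcoef_vertex wv.
Qed.

Lemma acoef1 a : acoef a 1 = 0.
Proof.
by rewrite -sum_vertex_elt pcoef_sum big1 // => v _; rewrite acoef_vertex.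
Qed.

Lemma vcoef_arrow_ideal v x : J x -> vcoef v x = 0.
Proof.
move=> /arrow_ideal_comb[y ->]; rewrite pcoef_sum big1 // => a _.
by rewrite vcoefM vcoef_arrow mulr0.
Qed.

Lemma acoef_ideal_exp2 a x : ideal_exp J 2 x -> acoef a x = 0.
Proof.
move=> J2x; pose K y := (forall v, vcoef v y = 0) /\ (forall b, acoef b y = 0).
suff KJ : ideal_exp J 2 `<=` K by have [] := KJ _ J2x.
apply: ideal_gen_smallest => [|_ [y [z [Jy Jz ->]]]].
  split=> [|y z [vy ay] [vz az]|y z [vz az]|y z [vz az]].
  - by split=> b; exact: pcoef0.
  - by split=> b; rewrite ?pcoefB ?vy ?vz ?ay ?az subr0.
  - by split=> b; rewrite ?vcoefM ?acoefM ?vz ?az !mulr0 ?addr0.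
  - by split=> b; rewrite ?vcoefM ?acoefM ?vz ?az !mul0r ?addr0.
have {}Jz : J z by exact: (@ideal_expS_sub k Q 0%N z).
split=> b; rewrite ?vcoefM ?acoefM ?(vcoef_arrow_ideal _ Jy) ?mul0r //.
by rewrite (vcoef_arrow_ideal _ Jz) mulr0 addr0.
Qed.

End Coefficients.

(** * Fans and cofans count arrows: the constructions *)

(** The projection of an algebra [B] onto [kQ/J^2], in coordinates: [tvert v]
    and [tarrow a] read the coefficients at the vertex [v] and at the arrow [a].
    Every representation of [Q] in which paths of length 2 act by 0 becomes a
    [B]-module through it. *)
Record truncation (k : fieldType) (Q : quiver) (B : pzRingType) := Truncation {
  tvert : vertex Q -> B -> k;
  tarrow : arrow Q -> B -> k;
  tvertD : forall v x y, tvert v (x + y) = tvert v x + tvert v y;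
  tarrowD : forall a x y, tarrow a (x + y) = tarrow a x + tarrow a y;
  tvert1 : forall v, tvert v 1 = 1;
  tarrow1 : forall a, tarrow a 1 = 0;
  tvertM : forall v x y, tvert v (x * y) = tvert v x * tvert v y;
  tarrowM : forall a x y,
    tarrow a (x * y)
    = tvert (tgt a) x * tarrow a y + tarrow a x * tvert (src a) y;
  truncation_surj : forall (c : k) (d : arrow Q -> k), exists x,
    (forall v, tvert v x = c) /\ (forall a, tarrow a x = d a)
}.

Section Modules.
Variables (k : fieldType) (Q : quiver) (B : pzRingType) (R : truncation k Q B).
Implicit Types (x y : B).

Section Semisimple.
Variables (U : finType) (l : U -> vertex Q).

(** The semisimple module with one basis vector at the vertex [l u] for each
    [u] in [U]. *)
Definition semi_scale x (f : {ffun U -> k}) : {ffun U -> k} :=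
  [ffun u => tvert R (l u) x * f u].

Fact semi_scaleA x y f : semi_scale x (semi_scale y f) = semi_scale (x * y) f.
Proof. by apply/ffunP => u; rewrite !ffunE tvertM mulrA. Qed.

Fact semi_scale1 : left_id 1 semi_scale.
Proof. by move=> f; apply/ffunP => u; rewrite !ffunE tvert1 mul1r. Qed.

Fact semi_scaleDr : right_distributive semi_scale +%R.
Proof. by move=> x f g; apply/ffunP => u; rewrite !ffunE mulrDr. Qed.

Fact semi_scaleDl f : {morph semi_scale^~ f : x y / x + y}.
Proof. by move=> x y; apply/ffunP => u; rewrite !ffunE tvertD mulrDl. Qed.

Definition semi : lmodType B := HB.pack_for (lmodType B) {ffun U -> k}
  (GRing.Zmodule_isLmodule.Build B {ffun U -> k}
     semi_scaleA semi_scale1 semi_scaleDr semi_scaleDl).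

End Semisimple.

Section TwoLayer.
Variables (U W : finType) (al : U -> W -> arrow Q).
Variables (lU : U -> vertex Q) (lW : W -> vertex Q).
Hypotheses (src_al : forall u w, src (al u w) = lU u).
Hypotheses (tgt_al : forall u w, tgt (al u w) = lW w).

Local Notation V := ({ffun U -> k} * {ffun W -> k})%type.

(** A module of Loewy length at most 2, with basis vectors [u] on the top layer
    and [w] on the bottom layer: the arrow [al u w] sends [u] to [w]. *)
Definition layer_scale x (m : V) : V :=
  ([ffun u => tvert R (lU u) x * m.1 u],
   [ffun w => tvert R (lW w) x * m.2 w + \sum_u tarrow R (al u w) x * m.1 u]).

Fact layer_scaleA x y m :
  layer_scale x (layer_scale y m) = layer_scale (x * y) m.
Proof.
congr (_, _); apply/ffunP => u; rewrite !ffunE /= tvertM.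
  by rewrite mulrA.
rewrite mulrDr mulrA -addrA; congr (_ + _).
rewrite mulr_sumr -big_split; apply: eq_bigr => i _ /=.
by rewrite !ffunE tarrowM src_al tgt_al mulrDl !mulrA.
Qed.

Fact layer_scale1 : left_id 1 layer_scale.
Proof.
move=> [f g]; congr (_, _); apply/ffunP => u; rewrite !ffunE /= tvert1 mul1r //.
by rewrite big1 ?addr0 // => i _; rewrite tarrow1 mul0r.
Qed.

Fact layer_scaleDr : right_distributive layer_scale +%R.
Proof.
move=> x [f g] [f' g']; congr (_, _); apply/ffunP => u.
all: rewrite !ffunE /= ?ffunE.
  by rewrite mulrDr.
rewrite mulrDr addrACA -big_split; congr (_ + _); apply: eq_bigr => i _ /=.
by rewrite ffunE mulrDr.
Qed.

Fact layer_scaleDl m : {morph layer_scale^~ m : x y / x + y}.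
Proof.
move=> x y; congr (_, _); apply/ffunP => u; rewrite !ffunE /= tvertD mulrDl //.
rewrite addrACA -big_split; congr (_ + _); apply: eq_bigr => i _ /=.
by rewrite tarrowD mulrDl.
Qed.

Definition layer : lmodType B := HB.pack_for (lmodType B) V
  (GRing.Zmodule_isLmodule.Build B V
     layer_scaleA layer_scale1 layer_scaleDr layer_scaleDl).

Lemma layerZ1 x (m : layer) u : (x *: m).1 u = tvert R (lU u) x * m.1 u.
Proof. exact: ffunE. Qed.

Lemma layerZ2 x (m : layer) w :
  (x *: m).2 w = tvert R (lW w) x * m.2 w + \sum_u tarrow R (al u w) x * m.1 u.
Proof. exact: ffunE. Qed.

Fact top_linear : linear (fst : layer -> semi lU).
Proof. by move=> x m n; apply/ffunP => u; rewrite !ffunE. Qed.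

Definition top : {linear layer -> semi lU} := linear_of top_linear.

Fact bottom_linear : linear ((fun g => (0, g)) : semi lW -> layer).
Proof.
move=> x g g'; congr (_, _); apply/ffunP => u.
  by rewrite !ffunE /= ?ffunE mulr0 addr0.
rewrite !ffunE /= ?ffunE big1 ?addr0 // => i _.
by rewrite ffunE mulr0.
Qed.

Definition bottom : {linear semi lW -> layer} := linear_of bottom_linear.

End TwoLayer.

Section Coordinates.
Variables (n : nat) (l : 'I_n -> vertex Q).

Definition simple_at v := semi (fun _ : unit => v).

Fact coord_linear i : linear ((fun t => [ffun j => if j == i then t tt else 0])
  : simple_at (l i) -> semi l).
Proof.
move=> x t t'; apply/ffunP => j; rewrite !ffunE /=.
by case: eqP => [->|_]; rewrite ?mulr0 ?addr0.
Qed.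

Definition coord i : {linear simple_at (l i) -> semi l} :=
  linear_of (@coord_linear i).

Lemma sum_coord (t : forall i, simple_at (l i)) j :
  (\sum_i coord i (t i)) j = t j tt.
Proof.
rewrite (big_morph (fun f : semi l => f j) (id1 := 0) (op1 := +%R)) //=.
- rewrite (bigD1 j) //= ffunE eqxx big1 ?addr0 // => i /negPf ij.
  by rewrite ffunE eq_sym ij.
- by move=> f g; rewrite ffunE.
- by rewrite ffunE.
Qed.

Lemma coord_jointly_monic : jointly_monic coord.
Proof.
move=> X h h0 i x; apply/ffunP => -[]; rewrite [RHS]ffunE.
by rewrite -(sum_coord (fun i => h i x)) h0 ffunE.
Qed.

Lemma simple_at_nonzero v : nonzero_mod (simple_at v).
Proof.
exists [ffun=> 1] => /ffunP/(_ tt) /eqP.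
by rewrite [X in _ == X]ffunE ffunE oner_eq0.
Qed.

End Coordinates.

(** The quotient of [P_v / rad^2 P_v] by the arrows that are not among the
    [al i]: one vector at [v] sent by the arrows [al i] to the [n] vectors of
    the bottom layer. *)
Lemma fan_of_arrows n (v : vertex Q) (al : 'I_n -> arrow Q) :
  injective al -> (forall i, src (al i) = v) -> fan B n.
Proof.
move=> al_inj al_src.
pose l i := tgt (al i).
pose M := layer (al := fun (_ : unit) => al) (lU := fun=> v) (lW := l)
  (fun=> al_src) (fun _ _ => erefl).
pose p : {linear M -> simple_at v} := top _ _.
pose b : {linear semi l -> M} := bottom _ _.
(* A vector with a nonzero top component generates the module. *)
have spin (m m' : M) : m.1 tt != 0 -> exists x, m' = x *: m.
  move=> m1; pose c := m'.1 tt / m.1 tt.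
  pose d a := if [pick i | al i == a] is Some i
    then (m'.2 i - c * m.2 i) / m.1 tt else 0.
  have [x [xv xa]] := truncation_surj R c d; exists x.
  apply/eqP; rewrite -pair_eqE; apply/andP; split; apply/eqP/ffunP => i.
    by rewrite layerZ1 xv; case: i; rewrite divfK.
  rewrite layerZ2 xv (big_pred1 tt) => [|[] //]; rewrite xa /d.
  case: pickP => [j /eqP /al_inj -> |/(_ i)]; last by rewrite eqxx.
  by rewrite divfK // addrC subrK.
exists M, (simple_at v), (fun i => simple_at (l i)), p.
exists (fun i => b \o coord l i).
split.
- by exists ([ffun=> 1], 0) => /ffunP/(_ tt)/eqP; rewrite /= !ffunE oner_eq0.
- move=> X h [x hx] Y u uh0 m'.
  have [|y ->] := spin (h x) m'.
    apply/eqP => hx0; apply: hx; apply/ffunP => -[]; rewrite [RHS]ffunE.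
    exact: hx0.
  by rewrite -linearZ_LR uh0.
- move=> X h h0; apply: coord_jointly_monic => x.
  have := h0 x; rewrite -raddf_sum => /(congr1 snd); exact.
- split=> [//|X h ph0].
  have h1 (x : X) u : (h x).1 u = 0.
    by have /ffunP/(_ u) := ph0 x; rewrite [RHS]ffunE.
  have h_lin i :
      linear ((fun x : X => [ffun=> (h x).2 i]) : X -> simple_at (l i)).
    move=> x y z; apply/ffunP => u; rewrite linearP !ffunE /=.
    by rewrite big1 ?addr0 // => j _; rewrite h1 mulr0.
  exists (fun i => linear_of (h_lin i)) => x.
  rewrite -raddf_sum; apply/eqP; rewrite -pair_eqE.
  apply/andP; split; apply/eqP.
    by apply/ffunP => u; rewrite h1 ffunE.
  by apply/ffunP => i; rewrite /= sum_coord ffunE.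
- by move=> i; exact: simple_at_nonzero.
Qed.

(** The dual of the previous module: [n] vectors on the top layer, each sent by
    its arrow [al i] to the only vector of the bottom layer. *)
Lemma cofan_of_arrows n (v : vertex Q) (al : 'I_n -> arrow Q) :
  injective al -> (forall i, tgt (al i) = v) -> cofan B n.
Proof.
move=> al_inj al_tgt.
pose l i := src (al i).
pose M := layer (al := fun i (_ : unit) => al i) (lU := l) (lW := fun=> v)
  (fun _ _ => erefl) (fun i _ => al_tgt i).
pose p : {linear M -> semi l} := top _ _.
pose s : {linear simple_at v -> M} := bottom _ _.
(* Every nonzero submodule contains the bottom layer. *)
have cospin (m : M) (g : simple_at v) : m <> 0 -> exists x, x *: m = s g.
  move=> m0.
  suff [x [xtop xbot]] : exists x, (x *: m).1 = 0 /\ (x *: m).2 tt = g tt.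
    exists x; apply/eqP; rewrite -pair_eqE; apply/andP; split; apply/eqP => //.
    by apply/ffunP => -[].
  have [[i mi]|m1] := pselect (exists i, m.1 i != 0).
    pose d a := if a == al i then g tt / m.1 i else 0.
    have [x [xv xa]] := truncation_surj R 0 d; exists x; split.
      by apply/ffunP => j; rewrite layerZ1 xv mul0r ffunE.
    rewrite layerZ2 xv mul0r add0r (bigD1 i) //= xa /d eqxx divfK //.
    rewrite big1 ?addr0 // => j ji.
    by rewrite xa /d (inj_eq al_inj) (negPf ji) mul0r.
  have {}m1 : m.1 = 0.
    apply/ffunP => j; rewrite [RHS]ffunE; apply/eqP/negPn/negP => mj.
    by apply: m1; exists j.
  have m2 : m.2 tt != 0.
    apply/eqP => m2; apply: m0; apply/eqP; rewrite -pair_eqE.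
    apply/andP; split; apply/eqP => //; apply/ffunP => -[].
    by rewrite m2 [RHS]ffunE.
  have [x [xv xa]] := truncation_surj R (g tt / m.2 tt) (fun=> 0).
  exists x; split.
    by apply/ffunP => j; rewrite layerZ1 m1 !ffunE mulr0.
  by rewrite layerZ2 xv divfK // big1 ?addr0 // => j _; rewrite xa mul0r.
exists (simple_at v), M, (semi l), (fun i => simple_at (l i)), s, p.
exists (@coord n l).
split.
- split.
    exists [ffun=> 1] => /(congr1 snd)/ffunP/(_ tt)/eqP.
    by rewrite [X in _ == X]ffunE /= ffunE oner_eq0.
  move=> X h [g hg] Y u hu0 y; apply: contrapT => uy0.
  have [x xE] := cospin _ g uy0.
  by apply: hg; rewrite -[LHS]/(h (s g)) -xE linearZ_LR hu0 scaler0.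
- split=> [//|X u u0 f]; exact: (u0 ((f, 0) : M)).
- move=> X h hs0.
  pose lift (f : semi l) : M := (f, 0).
  have hE (m : M) : h m = h (lift m.1).
    have mE : m = lift m.1 + s m.2.
      by apply/eqP; rewrite -pair_eqE /= addr0 add0r !eqxx.
    by rewrite -[RHS]addr0 -(hs0 m.2) -raddfD -mE.
  have h_lin : linear (fun f : semi l => h (lift f)).
    by move=> x f f'; rewrite -linearP [RHS]hE.
  by exists (linear_of h_lin).
- exact: coord_jointly_monic.
- by move=> i; exact: simple_at_nonzero.
Qed.

End Modules.

(** * The quotient of a path algebra by an admissible ideal *)

Section IdealImage.
Variables (R S : pzRingType) (f : {rmorphism R -> S}).
Hypothesis f_surj : forall y, exists x, f x = y.

Lemma ideal_image (I : set R) : is_ideal I -> is_ideal (f @` I).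
Proof.
move=> [I0 IB Il Ir]; split.
- by exists 0; rewrite ?rmorph0.
- move=> _ _ [x Ix <-] [y Iy <-].
  by exists (x - y); rewrite ?rmorphB //; apply: IB.
- move=> b _ [x Ix <-]; have [a <-] := f_surj b.
  by exists (a * x); rewrite ?rmorphM //; apply: Il.
- move=> b _ [x Ix <-]; have [a <-] := f_surj b.
  by exists (x * a); rewrite ?rmorphM //; apply: Ir.
Qed.

Lemma ideal_preimage (I : set S) : is_ideal I -> is_ideal (f @^-1` I).
Proof.
move=> [I0 IB Il Ir]; split=> /= [|x y Ix Iy|a x Ix|a x Ix].
- by rewrite rmorph0.
- by rewrite rmorphB; apply: IB.
- by rewrite rmorphM; apply: Il.
- by rewrite rmorphM; apply: Ir.
Qed.

Lemma ideal_exp_ideal (I : set R) n : is_ideal (ideal_exp I n).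
Proof. by case: n => [|n]; [split|exact: ideal_gen_ideal]. Qed.

Lemma ideal_exp_image_sub (I : set R) n :
  ideal_exp (f @` I) n `<=` f @` ideal_exp I n.
Proof.
elim: n => [y _|n IHn]; first by have [x <-] := f_surj y; exists x.
apply: ideal_gen_smallest; first exact: ideal_image (ideal_exp_ideal I n.+1).
move=> _ [_ [y [[x Ix <-] /IHn[z Iz <-] ->]]].
by exists (x * z); rewrite ?rmorphM //; apply: mem_ideal_mul.
Qed.

Lemma ideal_exp_image (I : set R) n x :
  ideal_exp I n x -> ideal_exp (f @` I) n (f x).
Proof.
elim: n x => [//|n IHn] x.
apply: (@ideal_gen_smallest _ _ (f @^-1` ideal_exp (f @` I) n.+1)).
  exact/ideal_preimage/ideal_gen_ideal.
move=> _ [y [z [Iy /IHn Iz ->]]] /=; rewrite rmorphM.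
by apply: mem_ideal_mul => //; exists y.
Qed.

End IdealImage.

Section Quotient.
Variables (k : fieldType) (Q : quiver) (I : ideal (path_alg k Q)).
Hypothesis admI : admissible I.
Local Notation kQ := (path_alg k Q).
Local Notation B := (quot_alg I).
Local Notation J := (@arrow_ideal k Q).

Lemma quot_pi_surj (b : B) : exists x, quot_pi I x = b.
Proof. by exists (quot_repr b); rewrite quot_reprK. Qed.

Lemma quot_pi_scale (c : k) (x : kQ) :
  quot_pi I (c *: x) = kmap c * quot_pi I x.
Proof. by rewrite scale_kmap rmorphM. Qed.

Lemma quot_rad_nilpotent :
  exists N, forall x, ideal_exp (quot_pi I @` J) N x -> x = 0.
Proof.
have [N [_ JI _]] := admI; exists N => x.
move=> /(ideal_exp_image_sub quot_pi_surj)[y /JI Iy <-].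
by rewrite -(rmorph0 (quot_pi I)); apply/quot_piP; rewrite subr0.
Qed.

Lemma quot_rad_comb (x : B) : (quot_pi I @` J) x ->
  exists y, x = \sum_a y a * quot_pi I (arrow_elt a).
Proof.
move=> [z /arrow_ideal_comb[y ->] <-]; exists (fun a => quot_pi I (y a)).
by rewrite rmorph_sum; apply: eq_bigr => a _; rewrite rmorphM.
Qed.

Lemma quot_vertex_decomp v (x : B) : exists (c : k) (d : arrow Q -> k) y,
  ideal_exp (quot_pi I @` J) 2 y /\
  x * quot_pi I (vertex_elt k v) = kmap c * quot_pi I (vertex_elt k v)
    + \sum_(a | src a == v) kmap (d a) * quot_pi I (arrow_elt a) + y.
Proof.
have [z <-] := quot_pi_surj x; have [c [d [y [Jy zE]]]] := vertex_decomp v z.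
exists c, d, (quot_pi I y); split; first exact: ideal_exp_image.
rewrite -rmorphM zE 2!rmorphD; congr (_ + _ + _); first exact: quot_pi_scale.
by rewrite rmorph_sum; apply: eq_bigr => a _; exact: quot_pi_scale.
Qed.

Lemma quot_frame : quiver_frame Q B.
Proof.
apply: (@QuiverFrame k Q B (fun v => quot_pi I (vertex_elt k v))
  (fun a => quot_pi I (arrow_elt a)) (quot_pi I @` J)).
- exact/ideal_image/arrow_ideal_ideal/quot_pi_surj.
- exact: quot_rad_nilpotent.
- by rewrite -rmorph_sum sum_vertex_elt rmorph1.
- by move=> v; rewrite -rmorphM vertex_eltM eqxx.
- by move=> v a /negPf av; rewrite -rmorphM vertex_arrow eq_sym av rmorph0.
- by move=> a; exists (arrow_elt a) => //; exact: arrow_in_ideal.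
- exact: quot_rad_comb.
- exact: quot_vertex_decomp.
Qed.

Local Notation vcoef v := (pcoef (trivial_path v)).
Local Notation acoef a := (pcoef (arrow_path a)).

Definition quot_vcoef v (b : B) : k := vcoef v (quot_repr b).
Definition quot_acoef a (b : B) : k := acoef a (quot_repr b).

(** The ideal lies in [J^2], so coefficients at paths of length at most one are
    well defined on the quotient. *)
Lemma quot_vcoefE v x : quot_vcoef v (quot_pi I x) = vcoef v x.
Proof.
have [N [_ _ IJ]] := admI; have /IJ/ideal_expS_sub := quot_repr_pi I x.
move=> /(vcoef_arrow_ideal v); rewrite pcoefB => /eqP.
by rewrite subr_eq0 => /eqP.
Qed.

Lemma quot_acoefE a x : quot_acoef a (quot_pi I x) = acoef a x.
Proof.
have [N [_ _ IJ]] := admI; have /IJ := quot_repr_pi I x.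
move=> /(acoef_ideal_exp2 a); rewrite pcoefB => /eqP.
by rewrite subr_eq0 => /eqP.
Qed.

Lemma quot_truncation : truncation k Q B.
Proof.
have ind (P : B -> Prop) : (forall x, P (quot_pi I x)) -> forall b, P b.
  by move=> Ppi b; have [x <-] := quot_pi_surj b.
apply: (@Truncation k Q B quot_vcoef quot_acoef).
- move=> v; elim/ind=> x; elim/ind=> y.
  by rewrite -quot_piD !quot_vcoefE pcoefD.
- move=> a; elim/ind=> x; elim/ind=> y.
  by rewrite -quot_piD !quot_acoefE pcoefD.
- by move=> v; rewrite -(rmorph1 (quot_pi I)) quot_vcoefE vcoef1.
- by move=> a; rewrite -(rmorph1 (quot_pi I)) quot_acoefE acoef1.
- move=> v; elim/ind=> x; elim/ind=> y.
  by rewrite -rmorphM !quot_vcoefE vcoefM.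
- move=> a; elim/ind=> x; elim/ind=> y.
  by rewrite -rmorphM !quot_vcoefE !quot_acoefE acoefM.
move=> c d; pose x : kQ := c *: (1 : kQ) + \sum_a d a *: arrow_elt a.
exists (quot_pi I x).
split=> [v|a]; rewrite ?quot_vcoefE ?quot_acoefE.
  rewrite pcoefD pcoefZ vcoef1 mulr1 pcoef_sum big1 ?addr0 // => a _.
  by rewrite pcoefZ vcoef_arrow mulr0.
rewrite pcoefD pcoefZ acoef1 mulr0 add0r pcoef_sum (bigD1 a) //= big1 ?addr0.
  by rewrite pcoefZ acoef_arrow eqxx mulr1.
by move=> b /negPf ba; rewrite pcoefZ acoef_arrow ba mulr0.
Qed.

Lemma fanP n : fan B n <->
  exists v, (n <= #|[pred a : arrow Q | src a == v]|)%N.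
Proof.
split=> [|[v le_n]]; first exact: fan_arrows quot_frame _.
apply: (fan_of_arrows quot_truncation (v := v)
  (al := fun i => enum_val (widen_ord le_n i))).
  by move=> i j /enum_val_inj /(congr1 val) ij; apply: val_inj.
by move=> i; have := enum_valP (widen_ord le_n i); rewrite inE => /eqP.
Qed.

Lemma cofanP n : cofan B n <->
  exists v, (n <= #|[pred a : arrow Q | tgt a == v]|)%N.
Proof.
split=> [|[v le_n]]; first exact: cofan_arrows quot_frame _.
apply: (cofan_of_arrows quot_truncation (v := v)
  (al := fun i => enum_val (widen_ord le_n i))).
  by move=> i j /enum_val_inj /(congr1 val) ij; apply: val_inj.
by move=> i; have := enum_valP (widen_ord le_n i); rewrite inE => /eqP.
Qed.

Lemma biserial_quiverP : biserial_quiver Q <-> ~ fan B 3 /\ ~ cofan B 3.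
Proof.
split=> [bisQ|[nofan nocofan] v].
  split=> [/fanP|/cofanP] [v]; have [le_s le_t] := bisQ v.
    by rewrite leqNgt ltnS le_s.
  by rewrite leqNgt ltnS le_t.
split; rewrite leqNgt; apply/negP => lt2.
  by apply: nofan; apply/fanP; exists v.
by apply: nocofan; apply/cofanP; exists v.
Qed.

End Quotient.

(** * Special multiserial and special quasi-biserial algebras *)

Theorem proposition2p7 (k : fieldType) (Q : quiver) (I : ideal (path_alg k Q))
    (I_admissible : admissible I)
    (A_fin_dim : finite_dimensional (quot_alg I))
    (A_multiserial : special_multiserial (quot_alg I))
    (A_quasi_biserial : special_quasi_biserial (quot_alg I)) :
  special_biserial (quot_alg I).
Proof.
have [Q1 [I1 [adm1 morita1 unique1]]] := A_multiserial.
have [Q2 [I2 [adm2 morita2 bisQ2 _]]] := A_quasi_biserial.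
have [nofan nocofan] := (biserial_quiverP adm2).1 bisQ2.
exists Q1, I1; split=> //; apply/(biserial_quiverP adm1); split.
  by move=> /(morita_fan _ morita1)/(morita_fan _ morita2).
by move=> /(morita_cofan _ morita1)/(morita_cofan _ morita2).
Qed.
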